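(* Let $f,g:[0;1]\to[0;1]^2$ be computable paths (computable in the sense of Grzegorczyk and Lacombe) such that $f(0)=(0,0)$, $f(1)=(1,1)$, $g(0)=(0,1)$ and $g(1)=(1,0)$. Then there is a computable point $x\in\mathbb{R}^2$ with $x\in\mathrm{range}(f)\cap\mathrm{range}(g)$.
   Context: A function $[0;1]\to\mathbb{R}^2$ is computable in the Grzegorczyk–Lacombe sense (type-2 computability with respect to the canonical Cauchy representations of reals). A point of $\mathbb{R}^2$ is computable if both coordinates are computable real numbers. *)

(* Defs.v *)
From HB Require Import structures.
From mathcomp Require Import all_boot all_order all_algebra.
From mathcomp Require Import all_classical all_reals all_analysis.
Import Order.TTheory GRing.Theory Num.Theory.
Import numFieldNormedType.Exports.

Set Implicit Arguments.
Unset Strict Implicit.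
Unset Printing Implicit Defensive.

Local Open Scope classical_set_scope.
Local Open Scope ring_scope.

(* [prog k n]: Kleene's mu-recursive definitions of partial functions of n
   natural numbers, relative to k function arguments (oracles) nat -> nat.
   For k = 0 these are exactly the partial recursive functions; for k = 1 and
   n = 1 they are the partial functionals on Baire space computed by type-2
   (oracle) machines. *)
Inductive prog (k : nat) : nat -> Type :=
| Zero n : prog k n
| Succ : prog k 1
| Proj n (i : 'I_n) : prog k n
| Oracle (i : 'I_k) : prog k 1
| Comp m n (h : prog k m) (g : 'I_m -> prog k n) : prog k n
| PrimRec n (b : prog k n) (s : prog k n.+2) : prog k n.+1
| Mu n (h : prog k n.+1) : prog k n.

Arguments Zero {k n}.
Arguments Succ {k}.
Arguments Proj {k n}.
Arguments Oracle {k}.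

(* [peval o c v y]: with oracles [o], [c] halts on [v] with value [y].
   In [PrimRec b s] the recursion variable comes first and [s] receives
   (j, value at j, parameters); in [Mu h] the sought variable comes first, and
   [h] must be defined on all smaller arguments. *)
Fixpoint peval k (o : k.-tuple (nat -> nat)) n (c : prog k n) {struct c} :
    n.-tuple nat -> nat -> Prop :=
  match c in prog _ n return n.-tuple nat -> nat -> Prop with
  | Zero _ => fun _ y => y = 0%N
  | Succ => fun v y => y = (thead v).+1
  | Proj _ i => fun v y => y = tnth v i
  | Oracle i => fun v y => y = tnth o i (thead v)
  | Comp m _ h g => fun v y => exists w : m.-tuple nat,
      (forall i, peval o (g i) v (tnth w i)) /\ peval o h w y
  | PrimRec n b s => fun v y =>
      (fix rec (j y : nat) {struct j} : Prop :=
         match j with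
         | 0 => peval o b [tuple of behead v] y
         | j.+1 => exists z, rec j z /\
                     peval o s [tuple of j :: z :: behead v] y
         end) (thead v) y
  | Mu n h => fun v y =>
      peval o h [tuple of y :: v] 0%N /\
      forall z, (z < y)%N -> exists u, peval o h [tuple of z :: v] u.+1
  end.

Lemma peval_functional k (o : k.-tuple (nat -> nat)) n (c : prog k n) v y y' :
  peval o c v y -> peval o c v y' -> y = y'.
Proof.
elim: c v y y' => {n} /= [n||n i|i|m n h IHh g IHg|n b IHb s IHs|n h IHh] v y y'.
- by move=> -> ->.
- by move=> -> ->.
- by move=> -> ->.
- by move=> -> ->.
- move=> [w [gw hw]] [w' [gw' hw']].
  have ww' : w = w' by apply: eq_from_tnth => i; apply: IHg (gw i) (gw' i).
  by apply: IHh hw _; rewrite ww'.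
- elim: (thead v) y y' => [|j IHj] y y'; first exact: IHb.
  move=> [z [rz sz]] [z' [rz' sz']].
  by apply: IHs sz _; rewrite (IHj _ _ rz rz').
- move=> [hy lty] [hy' lty'].
  case: (ltngtP y y') => // lt.
  + by have [u /(IHh _ _ _ hy)] := lty' _ lt.
  + by have [u /(IHh _ _ _ hy')] := lty _ lt.
Qed.

Definition computes k (c : prog k 1) (o : k.-tuple (nat -> nat))
    (q : nat -> nat) : Prop :=
  forall n, peval o c [tuple n] (q n).

Definition computable_seq (q : nat -> nat) : Prop :=
  exists c : prog 0 1, computes c [tuple] q.

(* Inverse of Cantor's pairing <i, j> = j + (i + j)(i + j + 1) / 2. *)
Fixpoint unpair (n : nat) : nat * nat :=
  if n is m.+1 then
    let: (i, j) := unpair m in if i is i'.+1 then (i', j.+1) else (j.+1, 0%N)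
  else (0%N, 0%N).

Lemma unpair_cantor i j : unpair (j + 'C((i + j).+1, 2)) = (i, j).
Proof.
move sE: (i + j)%N => s.
elim: s i j sE => [|s IHs] i j.
  by move/eqP; rewrite addn_eq0 => /andP[/eqP-> /eqP->].
elim: j i => [|j IHj] i.
  rewrite addn0 => ->; rewrite add0n binS bin1 addnC addSn /=.
  by rewrite (IHs 0%N s).
by rewrite addnS -addSn => /IHj; rewrite addSn /= => ->.
Qed.

(* The standard numbering <<i, j>, k> |-> (i - j) / (k + 1) of the rationals. *)
Definition nuQ (n : nat) : rat :=
  let: (m, k) := unpair n in let: (i, j) := unpair m in
  (i%:R - j%:R) / k.+1%:R.

(* A representation of X: [rho p x] means that [p] is a name of [x]. *)
Definition representation (X : Type) := (nat -> nat) -> X -> Prop.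

Definition cauchy_rep (R : realType) : representation R :=
  fun p x => forall n, `|ratr (nuQ (p n)) - x| <= 2 ^- n.

(* A name of a pair interleaves names of its components. *)
Definition prod_rep X Y (rhoX : representation X) (rhoY : representation Y) :
    representation (X * Y) :=
  fun p z => rhoX (fun n => p n.*2) z.1 /\ rhoY (fun n => p n.*2.+1) z.2.

(* [f], regarded as a function with domain [D], is (rhoX, rhoY)-computable. *)
Definition computable_on X Y (rhoX : representation X)
    (rhoY : representation Y) (D : set X) (f : X -> Y) : Prop :=
  exists c : prog 1 1, forall (p : nat -> nat) (x : X), D x -> rhoX p x ->
    exists q, computes c [tuple p] q /\ rhoY q (f x).

Definition computable_real (R : realType) (x : R) : Prop :=
  exists2 p, computable_seq p & cauchy_rep p x.

Definition computable_point (R : realType) (x : R * R) : Prop :=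
  computable_real x.1 /\ computable_real x.2.

Definition unit_square {R : realType} : set (R * R) :=
  `[0, 1]%classic `*` `[0, 1]%classic.

(* A path [0;1] -> [0;1]^2; values outside [0;1] are irrelevant. *)
Definition path_in_square (R : realType) (f : R -> R * R) : Prop :=
  {within `[0, 1]%classic, continuous f} /\
  f @` `[0, 1]%classic `<=` unit_square.

Definition computable_path (R : realType) (f : R -> R * R) : Prop :=
  path_in_square f /\
  computable_on (@cauchy_rep R) (prod_rep (@cauchy_rep R) (@cauchy_rep R))
    `[0, 1]%classic f.

(* Main.v *)
Require Import Defs.
From mathcomp Require Import all_boot all_order all_algebra.
From mathcomp Require Import all_classical all_reals all_analysis.
From mathcomp Require Import zify ring lra.
Import Order.TTheory GRing.Theory Num.Theory.
Import numFieldNormedType.Exports.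
Set Implicit Arguments.
Unset Strict Implicit.
Unset Printing Implicit Defensive.

(** If [f m] lies on [g] for some dyadic [m], then [f m] is a computable
    intersection point. Otherwise every [f m] has positive distance from [g], so
    one can compute on which side of [g] it lies: for a fine polygon
    approximating [g], take the parity of the number of edges which pass below
    [f m]. This parity is locally constant off the range of [g], and it differs at
    [f 0 = (0, 0)] and [f 1 = (1, 1)]. Bisection at dyadic points therefore
    computes a number [s] with points of both kinds on [f] arbitrarily close to
    [f s], and [f s] must lie on [g].

    The polygons need a computable modulus of continuity for [g]. A program for
    [g], run on a finite dyadic expansion, yields an approximation valid on the
    whole dyadic cell once it reads no more than that expansion; for every
    precision there is, by Koenig's lemma, a level at which this happens in all
    cells, and the program transformation [puse] lets us search for it. *)

(** * Programs: the reading bound and the substitution of oracles *)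

Section Programs.
Variable k : nat.
Implicit Types o : k.-tuple (nat -> nat).

(** The anonymous recursion inside [peval], with the parameters as a tuple [v] of their own. It is
    convertible to the original, which gives the usual recursion equations below. *)
Definition prec o n (b : prog k n) (s : prog k n.+2) (v : n.-tuple nat) :=
  fix rec (j y : nat) {struct j} : Prop :=
    if j is j.+1 then exists z, rec j z /\ peval o s [tuple of j :: z :: v] y
    else peval o b v y.

Lemma peval_prim o n (b : prog k n) s j (v : n.-tuple nat) y :
  peval o (PrimRec b s) [tuple of j :: v] y <-> prec o b s v j y.
Proof.
have -> : peval o (PrimRec b s) [tuple of j :: v] y =
  prec o b s [tuple of behead [tuple of j :: v]] (thead [tuple of j :: v]) y by [].
rewrite theadE.
by have -> : [tuple of behead [tuple of j :: v]] = v by apply: val_inj.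
Qed.

Lemma peval_prim0 o n (b : prog k n) s (v : n.-tuple nat) y :
  peval o (PrimRec b s) [tuple of 0 :: v] y <-> peval o b v y.
Proof. exact: peval_prim. Qed.

Lemma peval_primS o n (b : prog k n) s j (v : n.-tuple nat) y :
  peval o (PrimRec b s) [tuple of j.+1 :: v] y <->
  exists z, peval o (PrimRec b s) [tuple of j :: v] z /\
            peval o s [tuple of j :: z :: v] y.
Proof.
split=> [/peval_prim[z [/peval_prim h1 h2]]|[z [/peval_prim h1 h2]]].
  by exists z.
by apply/peval_prim; exists z.
Qed.

Lemma peval_comp o m n (h : prog k m) (g : 'I_m -> prog k n) v
    (w : 'I_m -> nat) (wt : m.-tuple nat) y :
  (forall i, tnth wt i = w i) -> (forall i, peval o (g i) v (w i)) ->
  peval o h wt y -> peval o (Comp h g) v y.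
Proof. by move=> e gw hw; exists wt; split => // i; rewrite e. Qed.

(** Bounds are combined by addition: it dominates every summand and is a single primitive
    recursion. *)
Definition padd n (a b : prog k n) : prog k n :=
  Comp (PrimRec (Proj ord0) (Comp Succ (fun _ : 'I_1 => Proj (@Ordinal 3 1 isT))))
    (fun i : 'I_2 => if i == ord0 then a else b).

Lemma peval_padd o n (a b : prog k n) v x y :
  peval o a v x -> peval o b v y -> peval o (padd a b) v (x + y).
Proof.
move=> ax by_.
apply: (@peval_comp _ _ _ _ _ _ (fun i => if i == ord0 then x else y)
    [tuple x; y]).
- by case=> -[|[|//]] i.
- by move=> i; case: ifP.
elim: x {ax} => [|x IH]; first exact/peval_prim0.
apply/peval_primS; exists (x + y); split => //.
by exists [tuple x + y]; split => // i; rewrite ord1.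
Qed.

Definition psum n (s : seq (prog k n)) : prog k n := foldr (@padd n) Zero s.

Lemma peval_psum o n (I : Type) (s : seq I) (G : I -> prog k n) v t :
  (forall i, peval o (G i) v (t i)) ->
  peval o (psum (map G s)) v (\sum_(i <- s) t i).
Proof.
move=> Gt; elim: s => [|i s IH]; first by rewrite big_nil.
by rewrite big_cons; apply: peval_padd.
Qed.

(* Omits the second argument. *)
Definition pskip n : 'I_n.+1 -> prog k n.+2 :=
  fun i => Proj (lift (@Ordinal n.+2 1 isT) i).

Lemma peval_pskip o n (c : prog k n.+1) j z (v : n.-tuple nat) y :
  peval o c [tuple of j :: v] y ->
  peval o (Comp c (@pskip n)) [tuple of j :: z :: v] y.
Proof.
move=> cy; apply: (@peval_comp _ _ _ _ _ _
  (fun i => tnth [tuple of [:: j, z & v]] (lift (@Ordinal n.+2 1 isT) i))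
  _ _ _ _ cy) => // i.
rewrite !(tnth_nth 0) /=; case: i => -[|i] hi //=.
Qed.

(* [puse c] bounds (by a sum) the oracle positions queried by [c]. *)
Fixpoint puse n (c : prog k n) : prog k n :=
  match c in prog _ n return prog k n with
  | Zero _ => Zero
  | Succ => Zero
  | Proj _ _ => Zero
  | Oracle _ => Succ
  | Comp m n h g =>
      padd (Comp (puse h) g) (psum [seq puse (g i) | i <- enum 'I_m])
  | PrimRec n b s =>
      PrimRec (puse b)
        (padd (Proj (@Ordinal n.+2 1 isT))
          (Comp (puse s) (fun i : 'I_n.+2 =>
             if i == 1 :> nat then Comp (PrimRec b s) (@pskip n) else Proj i)))
  | Mu n h =>
      Comp (PrimRec Zero
              (padd (Proj (@Ordinal n.+2 1 isT)) (Comp (puse h) (@pskip n))))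
        (fun i : 'I_n.+1 => if unlift ord0 i is Some j then Proj j
                            else Comp Succ (fun _ : 'I_1 => Mu h))
  end.

Definition agree u o o' :=
  forall i l, l < u -> tnth o' i l = tnth o i l.

Lemma agreeW u u' o o' : u' <= u -> agree u o o' -> agree u' o o'.
Proof. by move=> le a i l lu; apply: a; apply: leq_trans le. Qed.

(** A halting computation reads only finitely many oracle entries. The same [u] controls both [c]
    and [puse c], so the bound itself can be recognised from a finite part of the oracle. *)
Lemma puse_spec n (c : prog k n) o v y : peval o c v y ->
  exists u, forall o', agree u o o' ->
    peval o' c v y /\ peval o' (puse c) v u.
Proof.
elim: c v y => {n} [n||n i|i|m n h IHh g IHg|n b IHb s IHs|n h IHh] v y.
- by move=> yE; exists 0.
- by move=> yE; exists 0.
- by move=> yE; exists 0.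
- move=> /= ->; exists (thead v).+1 => o' a; split => //.
  by rewrite a.
- move=> [w [gw hw]].
  have [uh Huh] := IHh _ _ hw.
  have /fin_all_exists[ug Hug] := fun i => IHg i _ _ (gw i).
  exists (uh + \sum_(i <- enum 'I_m) ug i) => o' a.
  have [h1 h2] := Huh _ (agreeW (leq_addr _ _) a).
  have gi i : peval o' (g i) v (tnth w i) /\ peval o' (puse (g i)) v (ug i).
    apply: Hug; apply: agreeW a; apply: leq_trans (leq_addl _ _).
    by rewrite big_enum /= (bigD1 i) //= leq_addr.
  split; first by exists w; split => // i; have [] := gi i.
  apply: peval_padd.
    by exists w; split => // i; have [] := gi i.
  by apply: peval_psum => i; have [] := gi i.
(* In the recursion of [puse] the second argument holds the bound accumulated so far. The value of
   the original recursion, on which [puse s] depends, is therefore recomputed by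
   [Comp (PrimRec b s) (@pskip n)]. *)
- case/tupleP: v => j v.
  elim: j y => [|j IHj] y.
    move/peval_prim0 => /IHb[u Hu]; exists u => o' /Hu[h1 h2].
    by split; apply/peval_prim0.
  move=> /peval_primS[z [/IHj[u Hu] /IHs[u' Hu']]].
  exists (u + u') => o' a.
  have [h1 h2] := Hu _ (agreeW (leq_addr _ _) a).
  have [h3 h4] := Hu' _ (agreeW (leq_addl _ _) a).
  split; first by apply/peval_primS; exists z.
  apply/peval_primS; exists u; split => //.
  apply: peval_padd => //.
  apply: (@peval_comp _ _ _ _ _ _ (tnth [tuple of [:: j, z & v]]) _ _ _ _ h4)
    => // i.
  case: eqP => [i1|i1].
    have -> : tnth [tuple of [:: j, z & v]] i = z by rewrite (tnth_nth 0) i1.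
    exact: peval_pskip.
  by rewrite /= !(tnth_nth 0) /=; case: i i1 => -[|[|i]] hi.
(* The search evaluates [h] at 0, ..., [y], so the bounds at all these places are added; the
   recursion in [puse] runs up to the successor of [Mu h] in order to include [y]. *)
- move=> [hy hlt].
  have [u0 Hu0] := IHh _ _ hy.
  have /choice[uz Huz] : forall z, exists u, z < y ->
     exists x, forall o', agree u o o' -> peval o' h [tuple of z :: v] x.+1 /\
       peval o' (puse h) [tuple of z :: v] u.
    move=> z; case: (ltnP z y) => [/hlt[x /IHh[u Hu]]|_]; last by exists 0.
    by exists u => _; exists x.
  pose uu z := if z == y then u0 else uz z.
  exists (\sum_(0 <= z < y.+1) uu z) => o' a.
  have az z : z <= y -> agree (uu z) o o'.
    move=> zy; apply: agreeW a; rewrite big_mkord (bigD1 (Ordinal (n:=y.+1) (m:=z) _)) //=.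
    by rewrite leq_addr.
  have [h1 h2] : peval o' h [tuple of y :: v] 0 /\
                 peval o' (puse h) [tuple of y :: v] u0.
    by apply: Hu0; have := az y (leqnn y); rewrite /uu eqxx.
  have h3 z : z < y -> exists x, peval o' h [tuple of z :: v] x.+1 /\
       peval o' (puse h) [tuple of z :: v] (uz z).
    move=> zy; have [x Hx] := Huz z zy; exists x; apply: Hx.
    by have := az z (ltnW zy); rewrite /uu (ltn_eqF zy).
  have hmu : peval o' (Mu h) v y.
    by split => // z /h3[x [? _]]; exists x.
  split => //.
  apply: (@peval_comp _ _ _ _ _ _ (tnth [tuple of y.+1 :: v]) [tuple of y.+1 :: v])
    => // [i|].
    case: unliftP => [j ->|->].
      by rewrite /= !(tnth_nth 0).
    by exists [tuple y]; split => // i'; rewrite ord1.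
  have huse z : z <= y -> peval o' (puse h) [tuple of z :: v] (uu z).
    rewrite leq_eqVlt /uu; case: eqP => [-> //|_ /= /h3[x []//]].
  suff H z : z <= y.+1 -> peval o'
    (PrimRec Zero (padd (Proj (@Ordinal n.+2 1 isT)) (Comp (puse h) (@pskip n))))
    [tuple of z :: v] (\sum_(0 <= z' < z) uu z') by exact: H.
  elim: z => [|z IHz] zy.
    by apply/peval_prim0; rewrite big_nil.
  apply/peval_primS; exists (\sum_(0 <= z' < z) uu z'); split.
    exact: IHz (ltnW zy).
  rewrite big_nat_recr //=; apply: peval_padd => //.
  by apply: peval_pskip; apply: huse.
Qed.

End Programs.

(** The [q] parameters of the oracle program are appended after the arguments: recursion and search
    variables stay first, and [n.+1 + q] is convertible to [(n + q).+1]. *)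
Fixpoint psub q (orc : prog 0 q.+1) n (c : prog 1 n) : prog 0 (n + q) :=
  match c in prog _ n return prog 0 (n + q) with
  | Zero _ => Zero
  | Succ => Comp Succ (fun _ : 'I_1 => Proj (lshift q (@ord0 0)))
  | Proj _ i => Proj (lshift q i)
  | Oracle _ => orc
  | Comp m n h g => Comp (psub orc h) (fun i : 'I_(m + q) =>
      match fintype.split i with
      | inl i => psub orc (g i)
      | inr j => Proj (rshift n j)
      end)
  | PrimRec n b s => @PrimRec 0 (n + q) (psub orc b) (psub orc s)
  | Mu n h => @Mu 0 (n + q) (psub orc h)
  end.

Lemma psub_spec q (orc : prog 0 q.+1) (r : q.-tuple nat) (p : nat -> nat) :
  (forall l, peval [tuple] orc [tuple of l :: r] (p l)) ->
  forall n (c : prog 1 n) v y, peval [tuple p] c v y ->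
  peval [tuple] (psub orc c) [tuple of v ++ r] y.
Proof.
move=> orcp n c.
elim: c => {n} [n||n i|i|m n h IHh g IHg|n b IHb s IHs|n h IHh] v y.
- by [].
- move=> /= ->; case/tupleP: v => a v; exists [tuple a]; split => // i.
  by rewrite ord1 /= (tnth_nth 0).
- by move=> /= ->; rewrite tnth_lshift.
- case/tupleP: v => a v; rewrite /= ord1 /= theadE => ->.
  have := orcp a; congr (peval _ _ _ _); apply: val_inj => /=.
  by rewrite (tuple0 v).
- move=> [w [gw hw]]; exists [tuple of w ++ r]; split; last exact: IHh.
  move=> i; case: fintype.splitP => j ij.
    have -> : i = lshift q j by apply: val_inj.
    by rewrite tnth_lshift; apply: IHg; exact: gw.
  have -> : i = rshift m j by apply: val_inj.
  by rewrite /= !tnth_rshift.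
- case/tupleP: v => j v; elim: j y => [|j IHj] y.
    move/peval_prim0/IHb => H.
    have -> : [tuple of [tuple of 0 :: v] ++ r] = [tuple of 0 :: [tuple of v ++ r]].
      exact: val_inj.
    exact/peval_prim0.
  move=> /peval_primS[z [/IHj h1 /IHs h2]].
  have -> : [tuple of [tuple of j.+1 :: v] ++ r] = [tuple of j.+1 :: [tuple of v ++ r]].
    exact: val_inj.
  apply/peval_primS; exists z; split.
    by move: h1; congr (peval _ _ _ _); apply: val_inj.
  by move: h2; congr (peval _ _ _ _); apply: val_inj.
- move=> [hy hlt]; split.
    by have := IHh _ _ hy; congr (peval _ _ _ _); apply: val_inj.
  move=> z /hlt[u /IHh hu]; exists u.
  by move: hu; congr (peval _ _ _ _); apply: val_inj.
Qed.

(** * Total recursive functions *)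

Local Notation "v # i" := (nth 0%N v i) (at level 2, format "v # i").

(** [F] takes lists rather than tuples, so that an expression in [v#i] makes sense at every arity;
    only its values on lists of length [n] are constrained. *)
Definition recF n (F : seq nat -> nat) :=
  exists c : prog 0 n, forall v : n.-tuple nat, peval [tuple] c v (F v).

Local Notation rec1 f := (recF 1 (fun v => f v#0)).
Local Notation rec2 f := (recF 2 (fun v => f v#0 v#1)).
Local Notation rec3 f := (recF 3 (fun v => f v#0 v#1 v#2)).

Lemma recF_ext n F G : F =1 G -> recF n F -> recF n G.
Proof. by move=> FG [c cF]; exists c => v; rewrite -FG. Qed.

Lemma recF_comp m n F (G : 'I_m -> seq nat -> nat) : recF m F ->
  (forall i, recF n (G i)) -> recF n (fun v => F [tuple G i v | i < m]).
Proof.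
move=> [c cF] /fin_all_exists[d dG]; exists (Comp c d) => v.
by exists [tuple G i v | i < m]; split=> // i; rewrite tnth_mktuple.
Qed.

Lemma recF_app1 f n a : rec1 f -> recF n a -> recF n (fun v => f (a v)).
Proof.
move=> Hf Ha; have := recF_comp Hf (fun i : 'I_1 => Ha); apply: recF_ext => v /=.
by rewrite (nth_mktuple _ 0 (@ord0 0)).
Qed.

Lemma recF_app n m F (s : seq (seq nat -> nat)) : recF m F -> size s = m ->
  (forall i, i < m -> recF n (nth (fun=> 0) s i)) ->
  recF n (fun v => F (map (fun a => a v) s)).
Proof.
move=> HF sm Hs.
have := recF_comp HF (fun i : 'I_m => Hs i (ltn_ord i)); apply: recF_ext => v.
congr F; apply: (@eq_from_nth _ 0); first by rewrite size_map size_tuple.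
move=> i; rewrite size_tuple => im.
by rewrite (nth_mktuple _ 0 (Ordinal im)) (nth_map (fun=> 0)) ?sm.
Qed.

Lemma recF_app2 f n a b : rec2 f -> recF n a -> recF n b ->
  recF n (fun v => f (a v) (b v)).
Proof.
by move=> Hf Ha Hb; apply: (recF_app (s := [:: a; b]) Hf) => // -[|[|]].
Qed.

Lemma recF_app3 f n a b c : rec3 f -> recF n a -> recF n b -> recF n c ->
  recF n (fun v => f (a v) (b v) (c v)).
Proof.
by move=> Hf *; apply: (recF_app (s := [:: a; b; c]) Hf) => // -[|[|[|]]].
Qed.

Lemma recF_const n k : recF n (fun=> k).
Proof.
elim: k => [|k [c ck]]; first by exists Zero.
exists (Comp Succ (fun _ : 'I_1 => c)) => v.
by exists [tuple k]; split=> // i; rewrite ord1.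
Qed.

Lemma recF_var n i : recF n (fun v => v#i).
Proof.
(* Beyond the arity, [v#i] is the default value 0, a constant function. *)
have [lt|ge] := ltnP i n; last first.
  have [c c0] := recF_const n 0; exists c => v.
  by rewrite nth_default // size_tuple.
by exists (Proj (Ordinal lt)) => v; rewrite /= (tnth_nth 0).
Qed.

Lemma recF_dvar n m i : recF n (fun v => (drop m v)#i).
Proof. by apply: recF_ext (recF_var n (m + i)) => v; rewrite nth_drop. Qed.

Lemma recF_succ n a : recF n a -> recF n (fun v => (a v).+1).
Proof.
move=> [c ca]; exists (Comp Succ (fun _ : 'I_1 => c)) => v.
by exists [tuple a v]; split=> // i; rewrite ord1.
Qed.

Lemma recF_prim n (b : seq nat -> nat) (s : nat -> nat -> seq nat -> nat) e :
  recF n b -> recF n.+2 (fun w => s w#0 w#1 (drop 2 w)) -> recF n e ->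
  recF n (fun v => nat_rec (fun=> nat) (b v) (fun j z => s j z v) (e v)).
Proof.
move=> [cb Hb] [cs Hs] [ce He].
exists (Comp (PrimRec cb cs) (fun i : 'I_n.+1 =>
   if unlift ord0 i is Some j then Proj j else ce)) => v.
exists [tuple of e v :: v]; split.
  by move=> i; case: unliftP => [j ->|->]; rewrite /= ?(tnth_nth 0).
elim: (e v) => [|j IH]; first exact/peval_prim0.
apply/peval_primS; eexists; split; first exact: IH.
have := Hs [tuple of [:: j, nat_rec (fun=> nat) (b v) (fun j z => s j z v) j & v]].
by rewrite /= drop0.
Qed.

Lemma recF_iter n (b : seq nat -> nat) (s : nat -> seq nat -> nat) e :
  recF n b -> recF n.+2 (fun w => s w#1 (drop 2 w)) -> recF n e ->
  recF n (fun v => iter (e v) (s^~ v) (b v)).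
Proof.
by move=> Hb Hs He; apply: recF_ext (recF_prim (s := fun=> s) Hb Hs He).
Qed.

Lemma recF_mu n (P : nat -> seq nat -> bool) :
  recF n.+1 (fun w => P w#0 (behead w) : nat) ->
  (forall v : n.-tuple nat, exists y, P y v) ->
  exists2 F, recF n F & forall v : n.-tuple nat, P (F v) v.
Proof.
move=> [c cP] exP.
have /choice[F HF] : forall v : seq nat, exists y, size v = n ->
    P y v /\ forall z, z < y -> ~~ P z v.
  move=> v; have [e|] := pselect (size v = n); last by exists 0.
  have /ex_minnP[y Py ymin] : exists y, P y v.
    by have [y] := exP (Tuple (introT eqP e)); exists y.
  exists y => _; split => // z; rewrite ltnNge; apply: contra; exact: ymin.
exists F; last by move=> v; have [] := HF v (size_tuple v).
(* [Mu] looks for a zero, so the predicate is negated, by a recursion on its truth value with base 1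
   and step 0. *)
have [d dneg] : recF n.+1 (fun w => (~~ P w#0 (behead w)) : nat).
  have : recF n.+1 (fun w => nat_rec (fun=> nat) 1 (fun _ _ => 0)
     (P w#0 (behead w))).
    apply: (recF_prim (b := fun=> 1) (s := fun _ _ _ => 0)).
    - exact: recF_const.
    - exact: recF_const.
    - by exists c.
  by apply: recF_ext => w; case: (P _ _).
exists (Mu d) => v; have [PF lF] := HF v (size_tuple v); split.
  by have := dneg [tuple of F v :: v]; rewrite /= PF.
move=> z /lF Pz; exists 0.
by have := dneg [tuple of z :: v]; rewrite /= Pz.
Qed.

Lemma recF_add n a b : recF n a -> recF n b -> recF n (fun v => a v + b v).
Proof.
apply: recF_app2.
have := recF_iter (s := fun z _ => z.+1) (recF_var 2 1)
  (recF_succ (recF_var 4 1)) (recF_var 2 0).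
by apply: recF_ext => v; rewrite iter_succn addnC.
Qed.

Lemma recF_pred n a : recF n a -> recF n (fun v => (a v).-1).
Proof.
apply: recF_app1.
have := recF_prim (s := fun j _ _ => j) (recF_const 1 0)
  (recF_var 3 0) (recF_var 1 0).
by apply: recF_ext => v; case: v#0.
Qed.

Lemma recF_sub n a b : recF n a -> recF n b -> recF n (fun v => a v - b v).
Proof.
apply: recF_app2.
have := recF_iter (s := fun z _ => z.-1) (recF_var 2 0)
  (recF_pred (recF_var 4 1)) (recF_var 2 1).
by apply: recF_ext => v; rewrite iter_predn.
Qed.

Lemma recF_mul n a b : recF n a -> recF n b -> recF n (fun v => a v * b v).
Proof.
apply: recF_app2.
have := recF_iter (s := fun z v => z + v#1) (recF_const 2 0)
  (recF_add (recF_var 4 1) (recF_dvar 4 2 1)) (recF_var 2 0).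
apply: recF_ext => v /=.
by elim: v#0 => //= j ->; rewrite mulSn addnC.
Qed.

Lemma recF_exp n k a : recF n a -> recF n (fun v => k ^ a v).
Proof.
apply: recF_app1.
have := recF_iter (s := fun z _ => k * z) (recF_const 1 1)
  (recF_mul (recF_const 3 k) (recF_var 3 1)) (recF_var 1 0).
by apply: recF_ext => v /=; elim: v#0 => //= j ->; rewrite expnS.
Qed.

Lemma recF_leq n a b : recF n a -> recF n b ->
  recF n (fun v => nat_of_bool (a v <= b v)).
Proof.
move=> Ha Hb; have := recF_sub (recF_const n 1) (recF_sub Ha Hb).
by apply: recF_ext => v; rewrite /leq; case: (a v - b v).
Qed.

Lemma recF_neg n (a : seq nat -> bool) : recF n (fun v => nat_of_bool (a v)) ->
  recF n (fun v => nat_of_bool (~~ a v)).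
Proof.
move=> Ha; have := recF_sub (recF_const n 1) Ha.
by apply: recF_ext => v; case: (a v).
Qed.

Lemma recF_and n (a b : seq nat -> bool) : recF n (fun v => nat_of_bool (a v)) ->
  recF n (fun v => nat_of_bool (b v)) ->
  recF n (fun v => nat_of_bool (a v && b v)).
Proof.
move=> Ha Hb; have := recF_mul Ha Hb.
by apply: recF_ext => v; case: (a v); case: (b v).
Qed.

Lemma recF_or n (a b : seq nat -> bool) : recF n (fun v => nat_of_bool (a v)) ->
  recF n (fun v => nat_of_bool (b v)) ->
  recF n (fun v => nat_of_bool (a v || b v)).
Proof.
move=> Ha Hb; have := recF_neg (recF_and (recF_neg Ha) (recF_neg Hb)).
by apply: recF_ext => v; case: (a v); case: (b v).
Qed.

Lemma recF_odd n a : recF n a -> recF n (fun v => nat_of_bool (odd (a v))).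
Proof.
apply: (recF_app1 (f := fun a => odd a : nat)).
have := recF_iter (s := fun z _ => 1 - z) (recF_const 1 0)
  (recF_sub (recF_const 3 1) (recF_var 3 1)) (recF_var 1 0).
by apply: recF_ext => v; elim: v#0 => //= j ->; case: odd.
Qed.

Lemma recF_addb n (a b : seq nat -> bool) : recF n (fun v => nat_of_bool (a v)) ->
  recF n (fun v => nat_of_bool (b v)) ->
  recF n (fun v => nat_of_bool (a v (+) b v)).
Proof.
move=> Ha Hb; have := recF_odd (recF_add Ha Hb).
by apply: recF_ext => v; case: (a v); case: (b v).
Qed.

(** The recursion uses that half of [j.+1] is [j] minus half of [j], both rounded down. *)
Lemma recF_half n a : recF n a -> recF n (fun v => (a v)./2).
Proof.
apply: (recF_app1 (f := half)).
have := recF_prim (s := fun j z _ => j - z) (recF_const 1 0)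
  (recF_sub (recF_var 3 0) (recF_var 3 1)) (recF_var 1 0).
apply: recF_ext => v; elim: v#0 => //= j ->.
by have := odd_double_half j; rewrite uphalf_half; lia.
Qed.

Lemma recF_div_exp2 n a b : recF n a -> recF n b ->
  recF n (fun v => a v %/ 2 ^ b v).
Proof.
apply: (recF_app2 (f := fun a b => a %/ 2 ^ b)).
have := recF_iter (s := fun z _ => z./2) (recF_var 2 0)
  (recF_half (recF_var 4 1)) (recF_var 2 1).
apply: recF_ext => v; elim: v#1 => [|j /= ->]; first by rewrite divn1.
by rewrite expnSr divnMA divn2.
Qed.

Lemma recF_skip n G : recF n.+1 G -> recF n.+2 (fun w => G (w#0 :: drop 2 w)).
Proof.
move=> HG.
have [c cG] := recF_comp HG (fun i : 'I_n.+1 =>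
  recF_var n.+2 (if i == ord0 then 0 else i.+1)).
exists c => v; have := cG v.
congr (peval _ _ _ (G _)); apply: (@eq_from_nth _ 0).
  by rewrite size_tuple /= size_drop size_tuple subSS subn1.
move=> i; rewrite size_tuple => im.
rewrite (nth_mktuple _ 0 (Ordinal im)).
by case: i im => [|i] im //=; rewrite nth_drop add2n.
Qed.

Lemma recF_sum n (F : nat -> seq nat -> nat) e :
  recF n.+1 (fun w => F w#0 (drop 1 w)) -> recF n e ->
  recF n (fun v => \sum_(0 <= j < e v) F j v).
Proof.
move=> HF He.
have := recF_prim (s := fun j z v => z + F j v) (recF_const n 0) _ He.
move=> H; apply: recF_ext (H _); last first.
  apply: recF_add; first exact: recF_var.
  by apply: recF_ext (recF_skip HF) => w /=; rewrite drop0.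
by move=> v; elim: (e v) => [|j /= ->]; rewrite ?big_nil ?big_nat_recr.
Qed.

Lemma recF_all n (P : nat -> seq nat -> bool) e :
  recF n.+1 (fun w => P w#0 (drop 1 w) : nat) -> recF n e ->
  recF n (fun v => nat_of_bool (all (P^~ v) (iota 0 (e v)))).
Proof.
move=> HP He.
have := recF_leq (recF_sum (F := fun j v => ~~ P j v) (recF_neg HP) He)
  (recF_const n 0).
apply: recF_ext => v; congr nat_of_bool; rewrite leqn0 sum_nat_seq_eq0.
by rewrite /index_iota subn0; apply: eq_all => j; rewrite eqb0 negbK.
Qed.

(** Computations relative to a recursive family of oracles are recursive uniformly in the parameters
    [r]: [psub] puts the program for the family in place of the oracle. *)
Lemma recF_oracle q (orc : nat -> seq nat -> nat) (c : prog 1 1)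
    (Y : nat -> seq nat -> nat) :
  recF q.+1 (fun w => orc w#0 (drop 1 w)) ->
  (forall (r : q.-tuple nat) l, peval [tuple orc^~ r] c [tuple l] (Y l r)) ->
  recF q.+1 (fun w => Y w#0 (drop 1 w)).
Proof.
move=> [d dorc] cY; exists (psub d c : prog 0 q.+1) => v.
case/tupleP: v => l r; rewrite /= drop0.
have dr l' : peval [tuple] d [tuple of l' :: r] (orc l' r).
  by have := dorc [tuple of l' :: r]; rewrite /= drop0.
have := psub_spec dr (cY r l); congr (peval _ _ _ _).
exact: val_inj.
Qed.

(** * Recursive operations on codes of rational numbers *)

(* Syntactic matching, since unification would unfold the operations. *)
Ltac rec_step := lazymatch goal with
  | |- recF _ (fun v => nth _ v _) => apply: recF_var
  | |- recF _ (fun v => nth _ (drop _ v) _) => apply: recF_dvar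
  | |- recF _ (fun v => nat_of_bool (_ && _)) => apply: recF_and
  | |- recF _ (fun v => nat_of_bool (_ || _)) => apply: recF_or
  | |- recF _ (fun v => nat_of_bool (~~ _)) => apply: recF_neg
  | |- recF _ (fun v => nat_of_bool (_ (+) _)) => apply: recF_addb
  | |- recF _ (fun v => nat_of_bool (_ <= _)) => apply: recF_leq
  | |- recF _ (fun v => nat_of_bool (odd _)) => apply: recF_odd
  | |- recF _ (fun v => _ %/ 2 ^ _) => apply: recF_div_exp2
  | |- recF _ (fun v => _ ^ _) => apply: recF_exp
  | |- recF _ (fun v => _.+1) => apply: recF_succ
  | |- recF _ (fun v => _.-1) => apply: recF_pred
  | |- recF _ (fun v => _ - _) => apply: recF_sub
  | |- recF _ (fun v => _ + _) => apply: recF_add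
  | |- recF _ (fun v => _ * _) => apply: recF_mul
  end.
Ltac rec_tac := repeat first [ assumption | apply: recF_const | rec_step ].

Lemma recF_tri n a : recF n a -> recF n (fun v => 'C((a v).+1, 2)).
Proof.
apply: (recF_app1 (f := fun a => 'C(a.+1, 2))).
have : recF 1 (fun v => nat_rec (fun=> nat) 0 (fun j z => z + j.+1) v#0).
  by apply: (@recF_prim 1 (fun=> 0) (fun j z _ => z + j.+1)); rec_tac.
by apply: recF_ext => v; elim: v#0 => [|j IH] //=; rewrite IH [RHS]binS bin1.
Qed.

(** The index of the Cantor diagonal containing [n], that is the sum of the two components of
    [unpair n]: it grows whenever a triangular number is reached. *)
Definition diag n := nat_rec (fun=> nat) 0
  (fun j s => s + ('C(s.+2, 2) <= j.+1)) n.

Lemma unpair_diag n : let s := diag n in let j := n - 'C(s.+1, 2) in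
  [/\ 'C(s.+1, 2) + j = n, j <= s & unpair n = (s - j, j)].
Proof.
elim: n => [//|n /= [E le_s ->]].
have E2 : 'C((diag n).+2, 2) = 'C((diag n).+1, 2) + (diag n).+1.
  by rewrite [LHS]binS bin1.
set s := diag n in E le_s E2 *.
set j := n - 'C(s.+1, 2) in E le_s *.
(* Either the next code stays on the diagonal, or the diagonal is exhausted and the next one
   begins. *)
case: (ltngtP j s) le_s => // [lt|eq] _.
  have -> : ('C(s.+2, 2) <= n.+1) = false by lia.
  rewrite addn0; have -> : n.+1 - 'C(s.+1, 2) = j.+1 by lia.
  have -> : s - j = (s - j.+1).+1 by lia.
  by split => //; lia.
have -> : ('C(s.+2, 2) <= n.+1) by lia.
rewrite addn1; have -> : n.+1 - 'C(s.+2, 2) = 0 by lia.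
by rewrite -eq subnn subn0; split=> //; rewrite eq; lia.
Qed.

Lemma recF_diag n a : recF n a -> recF n (fun v => diag (a v)).
Proof.
apply: recF_app1.
apply: (@recF_prim 1 (fun=> 0) (fun j s _ => s + ('C(s.+2, 2) <= j.+1)));
  rec_tac; apply: recF_tri; rec_tac.
Qed.

Lemma recF_unpair2 n a : recF n a -> recF n (fun v => (unpair (a v)).2).
Proof.
move=> Ha; apply: (@recF_ext _ (fun v => a v - 'C((diag (a v)).+1, 2))).
  by move=> v; have [_ _ ->] := unpair_diag (a v).
by rec_tac => //; apply: recF_tri; apply: recF_diag.
Qed.

Lemma recF_unpair1 n a : recF n a -> recF n (fun v => (unpair (a v)).1).
Proof.
move=> Ha.
apply: (@recF_ext _ (fun v => diag (a v) - (a v - 'C((diag (a v)).+1, 2)))).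
  by move=> v; have [_ _ ->] := unpair_diag (a v).
by rec_tac => //; rewrite ?recF_tri //; do ?apply: recF_tri; apply: recF_diag.
Qed.

(* A code of [i / 2 ^ N]. *)
Definition dy (N i : nat) : nat := (2 ^ N).-1 + 'C(('C(i.+1, 2) + (2 ^ N).-1).+1, 2).

Lemma recF_dy n a b : recF n a -> recF n b -> recF n (fun v => dy (a v) (b v)).
Proof.
move=> Ha Hb; rewrite /dy; rec_tac => //; apply: recF_tri; rec_tac => //.
exact: recF_tri.
Qed.

Lemma unpair_dy N i : unpair (dy N i) = ('C(i.+1, 2), (2 ^ N).-1).
Proof. exact: unpair_cantor. Qed.

Lemma nuQ_dy N i : nuQ (dy N i) = (i%:R / 2 ^+ N :> rat)%R.
Proof.
rewrite /nuQ unpair_dy; have := unpair_cantor i 0; rewrite add0n addn0 => ->.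
by rewrite subr0 prednK ?expn_gt0 // natrX.
Qed.

(** The terms of positive sign in the numerator of [nuQ a - nuQ b] over the denominator
    [denomQ a b]; those of negative sign form [numerQ b a]. Thus only natural numbers occur. *)
Definition numerQ a b :=
  (unpair (unpair a).1).1 * (unpair b).2.+1 +
  (unpair (unpair b).1).2 * (unpair a).2.+1.

Definition denomQ a b := (unpair a).2.+1 * (unpair b).2.+1.

Lemma numerQ_sub (R : realType) a b :
  ((ratr (nuQ a) - ratr (nuQ b)) * (denomQ a b)%:R =
   (numerQ a b)%:R - (numerQ b a)%:R :> R)%R.
Proof.
rewrite /numerQ /denomQ /nuQ.
case: (unpair a) => m k; case: (unpair b) => m' k' /=.
case: (unpair m) => i j; case: (unpair m') => i' j' /=.
rewrite !fmorph_div /= !rmorphB /= !ratr_nat !natrD !natrM.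
by field; rewrite !nat1r !pnatr_eq0.
Qed.

Lemma recF_numerQ n a b : recF n a -> recF n b ->
  recF n (fun v => numerQ (a v) (b v)).
Proof.
move=> Ha Hb; rewrite /numerQ.
by rec_tac; do ?[apply: recF_unpair2 | apply: recF_unpair1].
Qed.

Lemma recF_denomQ n a b : recF n a -> recF n b ->
  recF n (fun v => denomQ (a v) (b v)).
Proof. by move=> Ha Hb; rewrite /denomQ; rec_tac; apply: recF_unpair2. Qed.

Definition ltQ a b := numerQ a b < numerQ b a.

Lemma ltQE (R : realType) a b :
  ltQ a b = (ratr (nuQ a) < ratr (nuQ b) :> R)%R.
Proof.
by rewrite /ltQ -(ltr_nat R) -subr_lt0 -numerQ_sub pmulr_llt0 ?subr_lt0 //.
Qed.

Lemma recF_ltQ n a b : recF n a -> recF n b ->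
  recF n (fun v => ltQ (a v) (b v) : nat).
Proof. by move=> Ha Hb; rewrite /ltQ; rec_tac; apply: recF_numerQ. Qed.

(** The two truncated differences add up to an absolute value. The constant 8 is the margin 6 of
    [cross_close] plus two approximation errors of [2 ^- n]. *)
Definition farQ n a b := 8 * denomQ a b <
  (numerQ a b - numerQ b a + (numerQ b a - numerQ a b)) * 2 ^ n.

Lemma farQE (R : realType) n a b :
  farQ n a b = (8 * 2 ^- n < `|ratr (nuQ a) - ratr (nuQ b)| :> R)%R.
Proof.
have D0 : (0 < (denomQ a b)%:R :> R)%R by rewrite ltr0n muln_gt0.
have P0 : (0 < 2 ^+ n :> R)%R by rewrite exprn_gt0.
rewrite -(ltr_pM2r D0) -[in RHS](gtr0_norm D0) -normrM numerQ_sub.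
rewrite (gtr0_norm D0) mulrAC ltr_pdivrMr // /farQ -(ltr_nat R) !natrM natrX natrD.
congr (_ < _ * _)%R.
have [le|le] := leqP (numerQ a b) (numerQ b a).
  by rewrite (eqP le) add0r natrB // distrC ger0_norm // subr_ge0 ler_nat.
by rewrite (eqP (ltnW le)) addr0 natrB ?(ltnW le) // ger0_norm // subr_ge0 ler_nat ltnW.
Qed.

Lemma recF_farQ m n a b : recF m n -> recF m a -> recF m b ->
  recF m (fun v => farQ (n v) (a v) (b v) : nat).
Proof.
move=> Hn Ha Hb; rewrite /farQ; rec_tac => //;
  solve [exact: recF_numerQ | exact: recF_denomQ].
Qed.

(** * Uniform approximation of computable functions on dyadic cells *)

Section Cells.
Local Open Scope ring_scope.
Variable R : realType.
Implicit Types x : R.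

Definition dyR (N i : nat) : R := i%:R / 2 ^+ N.

Lemma ratr_dyR N i : ratr (nuQ (dy N i)) = dyR N i.
Proof. by rewrite nuQ_dy /dyR fmorph_div /= rmorphXn /= !ratr_nat. Qed.

Definition cell N i x := dyR N i <= x <= dyR N i.+1.

Lemma exp2_gt0 N : 0 < 2 ^+ N :> R. Proof. by rewrite exprn_gt0. Qed.

Lemma dyRS N i : dyR N i.+1 = dyR N i + 2 ^- N.
Proof. by rewrite /dyR -natr1 mulrDl mul1r. Qed.

Lemma ler_dyR N i j : (i <= j)%N -> dyR N i <= dyR N j.
Proof. by move=> ij; rewrite /dyR ler_pM2r ?invr_gt0 ?exp2_gt0 // ler_nat. Qed.

Lemma dyR_refine N k i : dyR (N + k) (i * 2 ^ k) = dyR N i.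
Proof.
by rewrite /dyR exprD natrM natrX invfM mulrACA divff ?mulr1.
Qed.

Lemma cell_div N k i x : (k <= N)%N -> cell N i x -> cell k (i %/ 2 ^ (N - k)) x.
Proof.
move=> kN /andP[h1 h2]; have e := subnKC kN; set m := (N - k)%N in e *.
apply/andP; split.
  by apply: le_trans h1; rewrite -(dyR_refine k m) e ler_dyR // leq_trunc_div.
apply: (le_trans h2); rewrite -(dyR_refine k m) e ler_dyR // ltn_ceil //.
by rewrite expn_gt0.
Qed.

Lemma cell_unit N i x : (i < 2 ^ N)%N -> cell N i x -> 0 <= x <= 1.
Proof.
move=> iN /(cell_div (leq0n N)); rewrite subn0 divn_small //.
by rewrite /cell /dyR expr0 mul0r divr1.
Qed.

Lemma cell_dist N i x : cell N i x -> `|dyR N i - x| <= 2 ^- N.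
Proof.
by move=> /andP[h1]; rewrite dyRS => h2; rewrite distrC ger0_norm ?subr_ge0 //;
  lra.
Qed.

Lemma cell_left N i : cell N i (dyR N i).
Proof. by rewrite /cell lexx ler_dyR. Qed.

Lemma cell_right N i : cell N i (dyR N i.+1).
Proof. by rewrite /cell lexx ler_dyR. Qed.

Lemma dyR_unit N i : (i < 2 ^ N)%N -> 0 <= dyR N i <= 1.
Proof. by move/cell_unit; apply; apply: cell_left. Qed.

Lemma cell_exists k x : 0 <= x -> cell k (Num.truncn (x * 2 ^+ k)) x.
Proof.
move=> x0; have h : 0 <= x * 2 ^+ k by rewrite mulr_ge0 // ltW ?exp2_gt0.
have /andP[h1 h2] := truncn_itv h.
by rewrite /cell /dyR ler_pdivrMr ?exp2_gt0 // h1 ler_pdivlMr ?exp2_gt0 // ltW.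
Qed.

(** Nested intervals: every left end is below every right end, so the supremum of the left ends lies
    in all cells. *)
Lemma cell_limit (b : nat -> nat) :
  (forall N, b N.+1 = b N * 2 \/ b N.+1 = (b N * 2).+1)%N ->
  exists x, forall N, cell N (b N) x.
Proof.
move=> bS.
have lo N : dyR N (b N) <= dyR N.+1 (b N.+1).
  by rewrite -(dyR_refine N 1) expn1 addn1 ler_dyR //; case: (bS N) => ->.
have up N : dyR N.+1 (b N.+1).+1 <= dyR N (b N).+1.
  rewrite -(dyR_refine N 1) expn1 addn1 ler_dyR //.
  by case: (bS N) => ->; rewrite mulSn.
have loD N k : dyR N (b N) <= dyR (N + k) (b (N + k)%N).
  by elim: k => [|k IH]; rewrite ?addn0 // addnS (le_trans IH).
have upD N k : dyR (N + k) (b (N + k)%N).+1 <= dyR N (b N).+1.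
  by elim: k => [|k IH]; rewrite ?addn0 // addnS (le_trans (up _)).
have lu N M : dyR N (b N) <= dyR M (b M).+1.
  apply: le_trans (loD N M) _; apply: le_trans (ler_dyR _ (leqnSn _)) _.
  by rewrite addnC upD.
pose E := (range (fun N => dyR N (b N)) : set R).
have hE : has_sup E.
  by split; [exists (dyR 0 (b 0%N)), 0%N | exists (dyR 0 (b 0%N).+1) => _ [N _ <-]].
exists (sup E) => N; apply/andP; split.
  by apply: ub_le_sup; [exact: hE.2 | exists N].
by apply: ge_sup; [exact: hE.1 | move=> _ [M _ <-]].
Qed.

End Cells.

(* For [i < 2 ^ N], the first [N] entries of [dyname N i] are the beginning of
   a name of every point of the cell [i / 2 ^ N, (i + 1) / 2 ^ N]; the whole
   sequence is a name of its left end point. Larger [i] are clipped. *)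
Definition dyname N i k :=
  let i' := i - (i - (2 ^ N).-1) in dy (k - (k - N)) (i' %/ 2 ^ (N - k)).

(** The nested truncated subtractions in [dyname] are minima, written in a form that [rec_tac]
    recognises. *)
Lemma dynameE N i k : i < 2 ^ N ->
  dyname N i k = dy (minn k N) (i %/ 2 ^ (N - k)).
Proof.
move=> iN; rewrite /dyname -minnE; congr dy; congr (_ %/ _).
by lia.
Qed.

Lemma dyname_div N i N' i' k : N <= N' -> i' < 2 ^ N' ->
  i' %/ 2 ^ (N' - N) = i -> k < N -> dyname N' i' k = dyname N i k.
Proof.
move=> NN i'N e kN.
have iN : i < 2 ^ N.
  by rewrite -e ltn_divLR ?expn_gt0 // -expnD subnKC.
rewrite !dynameE // -e -divnMA -expnD.
have -> : (N' - N + (N - k))%N = (N' - k)%N by lia.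
by congr dy; lia.
Qed.

Lemma dyname_name (R : realType) N i : i < 2 ^ N ->
  cauchy_rep (dyname N i) (dyR R N i).
Proof.
move=> iN k; rewrite dynameE // ratr_dyR; have [kN|Nk] := leqP k N.
  by apply: cell_dist; apply: cell_div (cell_left _ _ _).
have /eqP -> : N - k == 0 by rewrite subn_eq0 ltnW.
by rewrite divn1 /dyR subrr normr0 invr_ge0 ltW ?exp2_gt0.
Qed.

(** From position [N] on, the name continues with left end points of cells containing [x] itself. *)
Lemma dyname_extend (R : realType) N i (x : R) : i < 2 ^ N -> cell N i x ->
  exists2 p, cauchy_rep p x & forall k, k < N -> p k = dyname N i k.
Proof.
move=> iN cx; have /andP[x0 _] := cell_unit iN cx.
exists (fun k => if k < N then dyname N i k else dy k (Num.truncn (x * 2 ^+ k)%R)).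
  move=> k; case: ltnP => kN; last first.
    by rewrite ratr_dyR; apply: cell_dist; apply: cell_exists.
  rewrite dynameE // (minn_idPl (ltnW kN)) ratr_dyR; apply: cell_dist.
  by apply: cell_div => //; apply: ltnW.
by move=> k ->.
Qed.

Lemma recF_dyname n a b c : recF n a -> recF n b -> recF n c ->
  recF n (fun v => dyname (a v) (b v) (c v)).
Proof. by move=> *; rewrite /dyname; apply: recF_dy; rec_tac. Qed.

Lemma agree1 u (o o' : nat -> nat) :
  (forall k, k < u -> o' k = o k) -> agree u [tuple o] [tuple o'].
Proof. by move=> a i l lu; rewrite !ord1 /= !(tnth_nth o) /= a. Qed.

Lemma branch_div (b : nat -> nat) N k :
  (forall N, b N.+1 = b N * 2 \/ b N.+1 = (b N * 2).+1) ->
  b (N + k) %/ 2 ^ k = b N.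
Proof.
move=> bS; elim: k => [|k IH]; first by rewrite addn0 divn1.
rewrite addnS expnS divnMA -[RHS]IH; congr (_ %/ _).
by case: (bS (N + k)) => ->; lia.
Qed.

(** * The maximum distance in the plane *)

Section Closeness.
Local Open Scope ring_scope.
Variable R : realType.
Implicit Types (p q z w : R * R) (e : R).

Definition pclose e p q := `|p.1 - q.1| <= e /\ `|p.2 - q.2| <= e.
Definition pfar e p q := e < `|p.1 - q.1| \/ e < `|p.2 - q.2|.

Lemma pclose_sym e p q : pclose e p q -> pclose e q p.
Proof. by rewrite /pclose !(distrC p.1) !(distrC p.2). Qed.

Lemma pclose_trans e e' p q z : pclose e p q -> pclose e' q z -> pclose (e + e') p z.
Proof.
move=> [h1 h2] [h3 h4]; split.
  by apply: le_trans (ler_distD q.1 _ _) _; apply: lerD.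
by apply: le_trans (ler_distD q.2 _ _) _; apply: lerD.
Qed.

Lemma pfar_close e e' p q z : pfar (e + e') p q -> pclose e' q z -> pfar e p z.
Proof.
move=> [h|h] [h1 h2]; [left|right].
  have := ler_distD z.1 p.1 q.1; rewrite (distrC z.1) => h3.
  by rewrite -(ltrD2r e'); apply: lt_le_trans h _; apply: le_trans h3 _; rewrite lerD2l.
have := ler_distD z.2 p.2 q.2; rewrite (distrC z.2) => h3.
by rewrite -(ltrD2r e'); apply: lt_le_trans h _; apply: le_trans h3 _; rewrite lerD2l.
Qed.

Lemma pfar_sym e p q : pfar e p q -> pfar e q p.
Proof. by rewrite /pfar !(distrC p.1) !(distrC p.2). Qed.

Lemma pfarW e e' p q : e <= e' -> pfar e' p q -> pfar e p q.
Proof. by move=> ee [h|h]; [left|right]; apply: le_lt_trans h. Qed.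

Definition codeR (a b : nat) : R * R := (ratr (nuQ a), ratr (nuQ b)).

End Closeness.

Section Approximation.
Variables (R : realType) (h : R -> R * R).
Hypothesis h_comp : computable_on (@cauchy_rep R)
  (prod_rep (@cauchy_rep R) (@cauchy_rep R)) `[0%R, 1%R]%classic h.

(* [A l N i] is entry [l] of a name of [h (i / 2 ^ N)], and [U l N i] bounds the
   part of [dyname N i] read to compute it. The last clause says that the cells
   with [U l N i <= N] form a bar. *)
Lemma approx_use : exists A U : nat -> nat -> nat -> nat,
 [/\ rec3 A, rec3 U,
  forall n N i, i < 2 ^ N ->
    pclose (2 ^- n)%R (codeR R (A (2 * n) N i) (A (2 * n).+1 N i)) (h (dyR R N i)),
  forall n N i x, i < 2 ^ N -> U (2 * n) N i <= N -> U (2 * n).+1 N i <= N ->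
    cell N i x ->
    pclose (2 ^- n)%R (codeR R (A (2 * n) N i) (A (2 * n).+1 N i)) (h x) &
  (forall l N i N' i', N <= N' -> i' < 2 ^ N' ->
    i' %/ 2 ^ (N' - N) = i -> U l N i <= N -> U l N' i' <= N') /\
  (forall l (b : nat -> nat), (forall N, b N < 2 ^ N) ->
    (forall N, b N.+1 = b N * 2 \/ b N.+1 = (b N * 2).+1) ->
    exists N, U l N (b N) <= N)].
Proof.
have [c Hc] := h_comp.
have ex (t : nat * nat * nat) : exists yu : nat * nat, forall o',
    agree yu.2 [tuple dyname t.1.2 t.2] o' ->
    peval o' c [tuple t.1.1] yu.1 /\ peval o' (puse c) [tuple t.1.1] yu.2.
  case: t => -[l N] i /=.
  (* Clipping, as in [dyname], makes every oracle in question a name of a point of the unit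
     interval; hence [c] halts for all triples, and [A] and [U] are total. *)
  pose i' := minn i (2 ^ N).-1.
  have i'N : i' < 2 ^ N.
    by have := expn_gt0 2 N; have := geq_minr i (2 ^ N).-1; rewrite /i'; lia.
  have -> : dyname N i = dyname N i'.
    by apply: funext => k; rewrite (dynameE _ i'N) /dyname -!minnE.
  have [q [Hq _]] := Hc _ _ (dyR_unit R i'N : `[0%R, 1%R]%classic (dyR R N i'))
     (dyname_name R i'N).
  by have [u Hu] := puse_spec (Hq l); exists (q l, u).
have [F HF] := choice ex.
pose A l N i := (F (l, N, i)).1; pose U l N i := (F (l, N, i)).2.
have HU l N i o' : agree (U l N i) [tuple dyname N i] o' ->
    peval o' c [tuple l] (A l N i) /\ peval o' (puse c) [tuple l] (U l N i).
  exact: HF (l, N, i) o'.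
have H0 l N i : peval [tuple dyname N i] c [tuple l] (A l N i) /\
    peval [tuple dyname N i] (puse c) [tuple l] (U l N i).
  exact: HU.
(* Applied to [c] and to [puse c], this makes [A] and [U] recursive. *)
have Urec (P : prog 1 1) (Y : nat -> nat -> nat -> nat) :
    (forall l N i, peval [tuple dyname N i] P [tuple l] (Y l N i)) -> rec3 Y.
  move=> HY.
  have Horc : recF 3 (fun w => dyname (drop 1 w)#0 (drop 1 w)#1 w#0).
    by apply: recF_dyname; rec_tac.
  have := @recF_oracle 2 (fun k r => dyname r#0 r#1 k) P
    (fun l r => Y l r#0 r#1) Horc (fun r l => HY l _ _).
  by apply: recF_ext => v; rewrite !nth_drop.
have val p x l : `[0%R, 1%R]%classic x -> cauchy_rep p x ->
    forall y1 y2, peval [tuple p] c [tuple (2 * l)] y1 ->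
    peval [tuple p] c [tuple (2 * l).+1] y2 ->
    pclose (2 ^- l)%R (codeR R y1 y2) (h x).
  move=> x01 px y1 y2 P1 P2; have [q [Hq [q1 q2]]] := Hc p x x01 px.
  rewrite (peval_functional P1 (Hq _)) (peval_functional P2 (Hq _)) mul2n.
  by split; [exact: q1 | exact: q2].
exists A, U; split.
- by apply: (Urec c) => l N i; have [] := H0 l N i.
- by apply: (Urec (puse c)) => l N i; have [] := H0 l N i.
- move=> n N i iN; apply: (val _ _ _ _ (dyname_name R iN)).
  + exact: dyR_unit.
  + by have [] := H0 (2 * n) N i.
  + by have [] := H0 (2 * n).+1 N i.
(* A name of [x] that begins like [dyname N i] cannot be told apart from it within the part read, so
   it yields the same output. *)
- move=> n N i x iN U1 U2 cx.
  have [p px pN] := dyname_extend iN cx.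
  apply: (val _ _ _ _ px); first exact: cell_unit cx.
  + have [] // := HU (2 * n) N i [tuple p].
    by apply: agree1 => k ku; apply: pN; apply: leq_trans U1.
  + have [] // := HU (2 * n).+1 N i [tuple p].
    by apply: agree1 => k ku; apply: pN; apply: leq_trans U2.
split.
- move=> l N i N' i' NN i'N e UN.
  have [_ h1] := H0 l N' i'.
  have [_ h2] : peval [tuple dyname N' i'] c [tuple l] (A l N i) /\
      peval [tuple dyname N' i'] (puse c) [tuple l] (U l N i).
    apply: HU; apply: agree1 => k ku; apply: dyname_div => //.
    exact: leq_trans UN.
  by rewrite (peval_functional h1 h2); apply: leq_trans NN.
(* The branch shrinks to a point [x]. On the name of [x] given by the branch the program halts with
   some bound [u]; at level [u] the cell name agrees with this name below [u], so its bound is [u]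
   too. *)
- move=> l b bN bS; have [x cx] := cell_limit R bS.
  pose p k := dy k (b k).
  have px : cauchy_rep p x by move=> k; rewrite /p ratr_dyR; apply: cell_dist.
  have [q [Hq _]] := Hc p x (cell_unit (bN 0) (cx 0)) px.
  have [u Hu] := puse_spec (Hq l); exists u.
  have [_ h1] := H0 l u (b u).
  have [_ h2] : peval [tuple dyname u (b u)] c [tuple l] (q l) /\
      peval [tuple dyname u (b u)] (puse c) [tuple l] u.
    apply: Hu; apply: agree1 => k ku; rewrite dynameE //.
    rewrite (minn_idPl (ltnW ku)) /p; congr dy.
    by rewrite -{1}(subnKC (ltnW ku)) branch_div.
  by rewrite (peval_functional h1 h2).
Qed.

(** At the left end points no level has to be searched for, since [dyname N i] is a full name of the
    point. *)
Lemma left_approx : exists F1 F2 : nat -> nat -> nat -> nat,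
 [/\ rec3 F1, rec3 F2 & forall n N i, i < 2 ^ N ->
    pclose (2 ^- n)%R (codeR R (F1 n N i) (F2 n N i)) (h (dyR R N i))].
Proof.
have [A [U [HA _ H _ _]]] := approx_use.
exists (fun n => A (2 * n)), (fun n => A (2 * n).+1); split => //.
  by apply: (recF_app3 HA); rec_tac.
by apply: (recF_app3 HA); rec_tac.
Qed.

(** Koenig's lemma for the binary tree of cells: if no level is good everywhere, then following
    halves without a good level gives a branch which never meets [P]. *)
Lemma konig_dyadic (P : nat -> nat -> Prop) :
  (forall N i N' i', N <= N' -> i' < 2 ^ N' -> i' %/ 2 ^ (N' - N) = i ->
     P N i -> P N' i') ->
  (forall b : nat -> nat, (forall N, b N < 2 ^ N) ->
    (forall N, b N.+1 = b N * 2 \/ b N.+1 = (b N * 2).+1) ->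
    exists N, P N (b N)) ->
  exists N, forall i, i < 2 ^ N -> P N i.
Proof.
move=> Pmono Pbar.
(* Some level is good for all subcells of the cell [i]. *)
pose Q N i := exists2 M, N <= M &
  forall j, j < 2 ^ M -> j %/ 2 ^ (M - N) = i -> P M j.
have [[M _ HM]|nQ] := pselect (Q 0 0).
  by exists M => i iM; apply: HM => //; rewrite subn0 divn_small.
have QS N i : Q N.+1 (i * 2) -> Q N.+1 (i * 2).+1 -> Q N i.
  move=> [M0 N0 H0] [M1 N1 H1].
  exists (maxn M0 M1) => [|j jM e]; first by rewrite leq_max ltnW.
  set j' := j %/ 2 ^ (maxn M0 M1 - N.+1).
  have e' : j' %/ 2 = i.
    rewrite -e /j' -divnMA -expnSr; congr (_ %/ 2 ^ _).
    by move: N0; rewrite -ltnS; lia.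
  have anc M : N < M -> M <= maxn M0 M1 ->
      (j %/ 2 ^ (maxn M0 M1 - M)) < 2 ^ M /\
      (j %/ 2 ^ (maxn M0 M1 - M)) %/ 2 ^ (M - N.+1) = j'.
    move=> NM MM; rewrite ltn_divLR ?expn_gt0 // -expnD subnKC //; split => //.
    by rewrite /j' -divnMA -expnD; congr (_ %/ 2 ^ _); lia.
  have [ej|ej] : j' = i * 2 \/ j' = (i * 2).+1 by lia.
    have [a1 a2] := anc M0 N0 (leq_maxl _ _).
    by apply: (Pmono M0 _ _ _ (leq_maxl _ _) jM erefl); exact: H0 a1 (etrans a2 ej).
  have [a1 a2] := anc M1 N1 (leq_maxr _ _).
  by apply: (Pmono M1 _ _ _ (leq_maxr _ _) jM erefl); exact: H1 a1 (etrans a2 ej).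
(* The branch turns right exactly when the left half has a good level; by [QS] the right half then
   has none. *)
pose b := nat_rec (fun=> nat) 0 (fun N i =>
  if pselect (Q N.+1 (i * 2)) then (i * 2).+1 else i * 2).
have bS N : b N.+1 = b N * 2 \/ b N.+1 = (b N * 2).+1.
  by rewrite /=; case: pselect; [right | left].
have nQb N : ~ Q N (b N).
  elim: N => //= N IH; case: pselect => // q1 q2; exact/IH/QS.
have bN N : b N < 2 ^ N.
  by elim: N => // N IH; rewrite expnS; case: (bS N) => ->; lia.
have [N PN] := Pbar b bN bS; case: (nQb N).
by exists N => // j _; rewrite subnn divn1 => ->.
Qed.

(** [T n] is a level at which, in every cell, entry [n] of both coordinates is computed by reading
    at most [T n] entries. [konig_dyadic] shows that such a level exists, and since the condition is
    decidable it is found by search. *)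
Lemma cell_approx : exists (T : nat -> nat) (G1 G2 : nat -> nat -> nat),
 [/\ rec1 T, rec2 G1, rec2 G2 & forall n j x, j < 2 ^ T n -> cell (T n) j x ->
    pclose (2 ^- n)%R (codeR R (G1 n j) (G2 n j)) (h x)].
Proof.
have [A [U [HA HU _ Hx [Umono Ubar]]]] := approx_use.
pose P y v := all (fun i => (U (2 * v#0) y i <= y) && (U (2 * v#0).+1 y i <= y))
  (iota 0 (2 ^ y)).
have recP : recF 2 (fun w => P w#0 (behead w) : nat).
  apply: (@recF_ext _ (fun w => all ((fun i w =>
    (U (2 * w#1) w#0 i <= w#0) && (U (2 * w#1).+1 w#0 i <= w#0))^~ w)
     (iota 0 (2 ^ w#0)))).
    by move=> w; rewrite /P nth_behead.
  apply: recF_all; last by rec_tac.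
  by rec_tac; apply: (recF_app3 HU); rec_tac.
have exP (v : 1.-tuple nat) : exists y, P y v.
  have [N HN] : exists N, forall i, i < 2 ^ N ->
      (U (2 * v#0) N i <= N) /\ (U (2 * v#0).+1 N i <= N).
    apply: (@konig_dyadic (fun N i => (U (2 * v#0) N i <= N) /\ (U (2 * v#0).+1 N i <= N))).
      move=> N i N' i' NN i'N e [u1 u2].
      by split; apply: (Umono _ _ _ _ _ NN i'N e).
    move=> b bN bS.
    have [N1 u1] := Ubar (2 * v#0) b bN bS.
    have [N2 u2] := Ubar (2 * v#0).+1 b bN bS.
    have anc M : M <= maxn N1 N2 -> b (maxn N1 N2) %/ 2 ^ (maxn N1 N2 - M) = b M.
      by move=> le; rewrite -{1}(subnKC le) branch_div.
    exists (maxn N1 N2); split.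
      exact: (Umono _ _ _ _ _ (leq_maxl _ _) (bN _) (anc _ (leq_maxl _ _)) u1).
    exact: (Umono _ _ _ _ _ (leq_maxr _ _) (bN _) (anc _ (leq_maxr _ _)) u2).
  exists N; apply/allP => i; rewrite mem_iota add0n => /HN[-> ->] //.
have [T HT PT] := recF_mu recP exP.
exists (fun n => T [:: n]), (fun n => A (2 * n) (T [:: n])),
  (fun n => A (2 * n).+1 (T [:: n])).
have rT : rec1 (fun n => T [:: n]).
  have := recF_app (n := 1) (s := [:: fun v => v#0]) HT erefl; apply => -[|j] // _; exact: recF_var.
split => //.
- by apply: (recF_app3 HA); rec_tac; apply: (recF_app1 (f := fun n => T [:: n]) rT); rec_tac.
- by apply: (recF_app3 HA); rec_tac; apply: (recF_app1 (f := fun n => T [:: n]) rT); rec_tac.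
move=> n j x jT cx; apply: Hx => //.
  by have /allP/(_ j) := PT [tuple n]; rewrite mem_iota add0n => /(_ jT)/andP[].
by have /allP/(_ j) := PT [tuple n]; rewrite mem_iota add0n => /(_ jT)/andP[].
Qed.

End Approximation.

(** * The crossing parity *)

(** In the application [chi] tells on which side of a vertical line a vertex lies, and [beta]
    whether it is low. Height is tested at the initial vertex of an edge, not at the crossing. *)
Definition par M (chi beta : nat -> bool) :=
  odd (\sum_(0 <= j < M) ((chi j (+) chi j.+1) && beta j)).

Lemma par0 chi beta : par 0 chi beta = false.
Proof. by rewrite /par big_nil. Qed.

Lemma parS M chi beta :
  par M.+1 chi beta = par M chi beta (+) ((chi M (+) chi M.+1) && beta M).
Proof. by rewrite /par big_nat_recr //= oddD oddb. Qed.

Lemma par_add M L chi beta : par (M + L) chi beta =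
  par M chi beta (+) par L (fun j => chi (M + j)) (fun j => beta (M + j)).
Proof.
elim: L => [|L IH]; first by rewrite addn0 par0 addbF.
by rewrite addnS !parS IH addnS addbA.
Qed.

Lemma par_const b L chi beta : (forall j, j < L -> beta j = b) ->
  par L chi beta = b && (chi 0 (+) chi L).
Proof.
elim: L => [|L IH] bb; first by rewrite par0 addbb andbF.
rewrite parS IH => [|j jL]; last by apply: bb; apply: ltnW.
by rewrite bb //; case: b {bb IH}; case: (chi 0); case: (chi L); case: (chi L.+1).
Qed.

(** Repeating each vertex [L] times adds only edges along which [chi] is constant; the last edge of
    each block is the original one. *)
Lemma par_refine M L chi beta : 0 < L ->
  par (M * L) (fun j => chi (j %/ L)) (fun j => beta (j %/ L)) = par M chi beta.
Proof.
move=> L0; elim: M => [|M IH]; first by rewrite !par0.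
rewrite mulSnr par_add IH parS; congr (_ (+) _).
rewrite (@par_const (beta M)) => [|j jL]; last by rewrite divnMDl // divn_small ?addn0.
by rewrite addn0 mulnK // divnMDl // divnn L0 addn1 andbC.
Qed.

Section Crossing.
Local Open Scope ring_scope.
Variable R : realType.
Implicit Types (p q z w : R * R) (P Q : nat -> R * R) (e : R).

(* The parity of the number of edges of the polygon [P 0], ..., [P M.-1] which
   cross the vertical line through [z] below [z]. There is one more edge,
   leading from [P M.-1] to a point right of [z]; it accounts for [j < M]. *)
Definition cross M P z :=
  par M (fun j => (j < M)%N && ((P j).1 < z.1)) (fun j => (P j).2 < z.2).

Lemma cross_refine M L P z : (0 < L)%N ->
  cross (M * L) (fun j => P (j %/ L)%N) z = cross M P z.
Proof.
move=> L0; rewrite /cross -[RHS](par_refine _ _ _ L0); congr par.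
by apply: funext => j; rewrite ltn_divLR.
Qed.

(** Each vertex is far from [z] horizontally, which fixes its [chi], or vertically, which fixes its
    [beta]. The margin [6 * e] exceeds a step [2 * e] plus the displacements [e] of vertex and
    point, so the fixed test also persists along the next or previous edge where needed. The
    remaining discrepancies [d] telescope and vanish at both ends. *)
Lemma cross_close M P Q z w e :
  (forall j, (j < M)%N -> pclose e (P j) (Q j)) -> pclose e z w ->
  (forall j, (j < M)%N -> pfar (6 * e) z (P j)) ->
  (forall j, (j < M)%N -> pclose (2 * e) (P j) (P j.+1)) ->
  z.2 <= (P 0%N).2 -> z.1 <= (P M).1 ->
  cross M P z = cross M Q w.
Proof.
move=> PQ [zw1 zw2] farP stepP P0 PM.
rewrite !ler_norml in zw1 zw2; have {zw1} /andP[zw1 zw1'] := zw1.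
have {zw2} /andP[zw2 zw2'] := zw2.
pose chi j := (j < M)%N && ((P j).1 < z.1).
pose chi' j := (j < M)%N && ((Q j).1 < w.1).
pose beta j := (P j).2 < z.2; pose beta' j := (Q j).2 < w.2.
have PQ' j : (j < M)%N -> [/\ - e <= (P j).1 - (Q j).1, (P j).1 - (Q j).1 <= e,
   - e <= (P j).2 - (Q j).2 & (P j).2 - (Q j).2 <= e].
  by move=> /PQ[]; rewrite !ler_norml => /andP[? ?] /andP[].
have stepP' j : (j < M)%N -> [/\ - (2 * e) <= (P j).1 - (P j.+1).1,
   (P j).1 - (P j.+1).1 <= 2 * e,
   - (2 * e) <= (P j).2 - (P j.+1).2 & (P j).2 - (P j.+1).2 <= 2 * e].
  by move=> /stepP[]; rewrite !ler_norml => /andP[? ?] /andP[].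
have farP' j : (j < M)%N -> [\/ 6 * e < z.1 - (P j).1, 6 * e < - (z.1 - (P j).1),
   6 * e < z.2 - (P j).2 | 6 * e < - (z.2 - (P j).2)].
  move=> /farP[]; rewrite ltr_normr => /orP[h|h].
  - by constructor 1.
  - by constructor 2.
  - by constructor 3.
  - by constructor 4.
have chi_eq j : (j < M)%N ->
    6 * e < z.1 - (P j).1 \/ 6 * e < - (z.1 - (P j).1) -> chi j = chi' j.
  move=> jM h; rewrite /chi /chi' jM /=; have [a1 a2 a3 a4] := PQ' j jM.
  by case: h => h; apply/idP/idP => h'; lra.
(* Where the horizontal tests differ, the vertex is vertically far, so the edge leading to it does
   not change height relative to [z]. *)
have C1 j : (j < M)%N -> chi j.+1 != chi' j.+1 -> beta j = beta j.+1.
  move=> jM; have [SjM|] := ltnP j.+1 M; last first.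
    by rewrite /chi /chi' ltnNge => ->.
  have [b1 b2 b3 b4] := stepP' j jM.
  case: (farP' _ SjM) => h.
  - by rewrite (chi_eq _ SjM) ?eqxx //; left.
  - by rewrite (chi_eq _ SjM) ?eqxx //; right.
  - by move=> _; rewrite /beta; apply/idP/idP => h'; lra.
  - by move=> _; rewrite /beta; apply/idP/idP => h'; lra.
(* Where the vertical tests differ, the vertex is horizontally far, so the edge leaving it crosses
   in neither picture. *)
have C2 j : (j < M)%N -> beta j != beta' j ->
    [/\ chi j = chi' j, chi j.+1 = chi j & chi' j.+1 = chi j].
  move=> jM nb; have [a1 a2 a3 a4] := PQ' j jM.
  have [b1 b2 b3 b4] := stepP' j jM.
  have h : 6 * e < z.1 - (P j).1 \/ 6 * e < - (z.1 - (P j).1).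
    case: (farP' j jM) => h; [by left | by right | |]; exfalso;
    by move/eqP: nb; apply; rewrite /beta /beta'; apply/idP/idP => h'; lra.
  split; first exact: chi_eq.
    rewrite /chi jM /=; have [SjM|SjM] := ltnP j.+1 M.
      by case: h => h; apply/idP/idP => h'; lra.
    (* At the last vertex [chi] is cut off to false; since [P M] is not left of [z], a vertex one
       step away cannot be far to the left. *)
    have eM : M = j.+1 by apply/eqP; rewrite eqn_leq SjM jM.
    rewrite eM in PM; case: h => h; symmetry; apply/negP => h'; lra.
  rewrite /chi /chi' jM /=; have [SjM|SjM] := ltnP j.+1 M.
    have [c1 c2 c3 c4] := PQ' _ SjM.
    by case: h => h; apply/idP/idP => h'; lra.
  have eM : M = j.+1 by apply/eqP; rewrite eqn_leq SjM jM.
  rewrite eM in PM; case: h => h; symmetry; apply/negP => h'; lra.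
pose d j := (chi j (+) chi' j) && beta j.
(* Each edge contributes the same parity to both sides up to [d j (+) d j.+1]. *)
have tele m : (m <= M)%N -> par m chi beta (+) par m chi' beta' = d 0%N (+) d m.
  elim: m => [|m IH] mM; first by rewrite !par0 !addbb.
  have {IH} := IH (ltnW mM); rewrite !parS /d.
  case: (eqVneq (beta m) (beta' m)) => [<-|/(C2 _ mM)[<- -> ->]]; last first.
    by rewrite !addbb !addbF.
  have -> : (chi m.+1 (+) chi' m.+1) && beta m.+1 =
            (chi m.+1 (+) chi' m.+1) && beta m.
    by case: (eqVneq (chi m.+1) (chi' m.+1)) => [->|/(C1 _ mM) -> //]; rewrite addbb.
  move: (par m chi beta) (par m chi' beta') (_ && beta 0%N) => x y t E.
  have {E} -> : x = t (+) ((chi m (+) chi' m) && beta m) (+) y.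
    by rewrite -E -addbA addbb addbF.
  by case: (beta m); case: (chi m); case: (chi' m); case: (chi m.+1);
    case: (chi' m.+1); case: y; case: t.
have d0 : d 0%N = false by rewrite /d /beta ltNge P0 andbF.
have dM : d M = false by rewrite /d /chi /chi' ltnn.
have := tele M (leqnn M); rewrite d0 dM => /eqP.
by rewrite /cross -/chi -/chi'; case: (par M chi beta); case: (par M chi' _).
Qed.

Lemma cross_lower M P z : (forall j, (j < M)%N -> z.1 <= (P j).1) ->
  cross M P z = false.
Proof.
move=> h; rewrite /cross /par big1_seq // => j /andP[_].
rewrite mem_index_iota => /andP[_ jM]; rewrite jM /= ltNge h //=.
by case: ltnP => //= SjM; rewrite ltNge h.
Qed.

(** A vertex at exactly the height of [z] is horizontally far, so no crossing edge starts there.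
    Hence all crossings count, and their parity is determined by the first and last values of
    [chi]. *)
Lemma cross_upper M P z e : (0 < M)%N ->
  (forall j, (j < M)%N -> pfar (6 * e) z (P j)) ->
  (forall j, (j < M)%N -> pclose (2 * e) (P j) (P j.+1)) ->
  (forall j, (j <= M)%N -> (P j).2 <= z.2) ->
  (P 0%N).1 < z.1 -> z.1 <= (P M).1 ->
  cross M P z.
Proof.
move=> M0 farP stepP Pz P0 PM.
pose chi j := (j < M)%N && ((P j).1 < z.1).
suff H m : (m <= M)%N -> par m chi (fun j => (P j).2 < z.2) = chi 0%N (+) chi m.
  by rewrite /cross -/chi H // /chi M0 P0 ltnn.
elim: m => [|m IH] mM; first by rewrite par0 addbb.
rewrite parS IH ?(ltnW mM) //.
suff : chi m != chi m.+1 -> (P m).2 < z.2.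
  case: (chi m); case: (chi m.+1); rewrite ?eqxx //=; try by rewrite !addbF.
    by move=> -> //; case: (chi 0%N).
  by move=> -> //; case: (chi 0%N).
move=> nchi; have [] := stepP m mM; rewrite !ler_norml => /andP[a1 a2] /andP[a3 a4].
have := Pz m (ltnW mM); rewrite le_eqVlt => /orP[/eqP e2|//].
exfalso; case: (farP m mM); last by rewrite e2 subrr normr0; lra.
rewrite ltr_normr => h; move/eqP: nchi; apply; rewrite /chi mM /=.
have [SmM|SmM] := ltnP m.+1 M.
  by case/orP: h => h; apply/idP/idP => h'; lra.
have eM : M = m.+1 by apply/eqP; rewrite eqn_leq SmM mM.
by rewrite eM in PM; apply/negP => h'; case/orP: h => h; lra.
Qed.

End Crossing.

(** * The side of a curve on which a point lies *)

Lemma computable_seq_rec1 q : rec1 q -> computable_seq q.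
Proof. by move=> [c cq]; exists c => n; exact: cq [tuple n]. Qed.

Lemma computable_image (R : realType) (h : R -> R * R) p x :
  computable_on (@cauchy_rep R) (prod_rep (@cauchy_rep R) (@cauchy_rep R))
    `[0%R, 1%R]%classic h ->
  (0 <= x <= 1)%R -> rec1 p -> cauchy_rep p x -> computable_point (h x).
Proof.
move=> [c Hc] x01 rp px; have [q [Hq [q1 q2]]] := Hc p x x01 px.
have rq : rec1 q.
  exact: (@recF_oracle 0 (fun k _ => p k) c (fun l _ => q l) rp (fun _ l => Hq l)).
split; [exists (fun n => q n.*2) | exists (fun n => q n.*2.+1)] => //;
  apply: computable_seq_rec1; apply: (recF_app1 rq).
  by apply: (@recF_ext _ (fun v => 2 * v#0)) => [v|]; [rewrite mul2n | rec_tac].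
by apply: (@recF_ext _ (fun v => (2 * v#0).+1)) => [v|]; [rewrite mul2n | rec_tac].
Qed.

Section Main.
Local Open Scope classical_set_scope.
Local Open Scope ring_scope.
Variable R : realType.

Lemma exp2_small (e : R) : 0 < e -> exists n, 2 ^- n < e.
Proof.
move=> e0; exists (Num.Def.archi_bound e^-1).
rewrite -[ltRHS]invrK ltf_pV2 ?posrE ?exp2_gt0 ?invr_gt0 //.
exact: upper_nthrootP.
Qed.

(** The range of [g] is compact, hence closed, so a ball around [z] misses it. The factor 10 is the
    8 tested by [farQ] plus the errors of two approximations. *)
Lemma far_of_notin (g : R -> R * R) (z : R * R) :
  {within `[0, 1]%classic, continuous g} ->
  ~ (g @` `[0, 1]%classic) z ->
  exists n, forall t, 0 <= t <= 1 -> pfar (10 * 2 ^- n) z (g t).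
Proof.
move=> gcont zg.
have gclosed : closed (g @` `[0, 1]%classic).
  apply: compact_closed; first exact: norm_hausdorff.
  exact: continuous_compact gcont (@segment_compact R 0 1).
have /open_nbhs_nbhs : open_nbhs z (~` (g @` `[0, 1]%classic))%classic.
  by split => //; exact: closed_openC.
move=> /nbhs_ballP[e /= e0 He].
have [n ne] : exists n, 2 ^- n < e / 10 by apply: exp2_small; rewrite divr_gt0.
exists n => t t01.
have ne' : 10 * 2 ^- n < e by rewrite mulrC -ltr_pdivlMr.
have [h1|h1] := ltP (10 * 2 ^- n) `|z.1 - (g t).1|; first by left.
have [h2|h2] := ltP (10 * 2 ^- n) `|z.2 - (g t).2|; first by right.
exfalso; apply: (He (g t)); last by exists t.
by split; rewrite -ball_normE /=; apply: le_lt_trans ne'.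
Qed.

Section Winding.
Variables (g : R -> R * R) (T : nat -> nat) (G1 G2 : nat -> nat -> nat).
Hypotheses (gin : g @` `[0, 1]%classic `<=` unit_square)
  (gcont : {within `[0, 1]%classic, continuous g})
  (g0 : g 0 = (0, 1)) (g1 : g 1 = (1, 0)).

Hypothesis gT : forall n j (t : R), (j < 2 ^ T n)%N -> cell (T n) j t ->
  pclose (2 ^- n) (codeR R (G1 n j) (G2 n j)) (g t).

Definition gpt N j := g (dyR R N j).
Definition wind N z := cross (2 ^ N) (gpt N) z.
(** The side of [g] on which [z] lies. Eventual constancy lets points settled at different levels be
    compared at a common large [N]. *)
Definition wind_lim z b := exists N0, forall N, (N0 <= N)%N -> wind N z = b.

Lemma dyR_le1 N j : (j <= 2 ^ N)%N -> 0 <= dyR R N j <= 1.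
Proof.
move=> jN; rewrite /dyR divr_ge0 ?ler0n //= ?(ltW (exp2_gt0 _ _)) //.
by rewrite ler_pdivrMr ?exp2_gt0 // mul1r -natrX ler_nat.
Qed.

Lemma gsq t : 0 <= t <= 1 -> [/\ 0 <= (g t).1, (g t).1 <= 1, 0 <= (g t).2 & (g t).2 <= 1].
Proof.
move=> t01; have [] : unit_square (g t) by apply: gin; exists t.
by rewrite /= !in_itv /= => /andP[? ?] /andP[].
Qed.

Lemma gpt0 N : gpt N 0 = (0, 1).
Proof. by rewrite /gpt /dyR mul0r g0. Qed.

Lemma gpt1 N : gpt N (2 ^ N) = (1, 0).
Proof. by rewrite /gpt /dyR natrX divff ?g1 // gt_eqF // exp2_gt0. Qed.

(** Both ends of the edge lie in one cell of level [T n], where [g] stays within [2 ^- n] of a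
    single code. *)
Lemma gstep n N j : (T n <= N)%N -> (j < 2 ^ N)%N ->
  pclose (2 * 2 ^- n) (gpt N j) (gpt N j.+1).
Proof.
move=> TN jN.
have jT : (j %/ 2 ^ (N - T n) < 2 ^ T n)%N.
  by rewrite ltn_divLR ?expn_gt0 // -expnD subnKC.
rewrite mulr_natl mulr2n; apply: (@pclose_trans _ _ _ _ (codeR R (G1 n _) (G2 n _))).
  by apply: pclose_sym; apply: gT jT (cell_div TN (cell_left _ _ _)).
exact: gT jT (cell_div TN (cell_right _ _ _)).
Qed.

Lemma wind_local n N z z' : z.1 <= 1 -> z.2 <= 1 -> (T n <= N)%N ->
  (forall t, 0 <= t <= 1 -> pfar (6 * 2 ^- n) z (g t)) ->
  pclose (2 ^- n) z z' -> wind N z = wind N z'.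
Proof.
move=> z1 z2 TN zfar zz'; apply: (@cross_close _ _ _ _ _ _ (2 ^- n)) => //.
- by move=> j _; split; rewrite subrr normr0 invr_ge0 ltW ?exp2_gt0.
- by move=> j jN; apply: zfar; apply: dyR_unit.
- by move=> j jN; apply: gstep.
- by rewrite gpt0.
- by rewrite gpt1.
Qed.

(** The left side involves only rationals and is computable. Repeating its vertices brings it to
    level [N], where [cross_close] compares it with the polygon on [g]. *)
Lemma wind_code n N z a b : z.1 <= 1 -> z.2 <= 1 -> (T n <= N)%N ->
  pclose (2 ^- n) (codeR R a b) z ->
  (forall j, (j < 2 ^ T n)%N -> pfar (8 * 2 ^- n) (codeR R (G1 n j) (G2 n j)) (codeR R a b)) ->
  cross (2 ^ T n) (fun j => codeR R (G1 n j) (G2 n j)) (codeR R a b) = wind N z.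
Proof.
move=> z1 z2 TN zab safe; set P := (fun j => codeR R _ _).
rewrite -(@cross_refine _ _ (2 ^ (N - T n))) ?expn_gt0 // -expnD subnKC //.
have jT j : (j < 2 ^ N)%N -> (j %/ 2 ^ (N - T n) < 2 ^ T n)%N.
  by move=> jN; rewrite ltn_divLR ?expn_gt0 // -expnD subnKC.
have Pg j : (j < 2 ^ N)%N -> pclose (2 ^- n) (P (j %/ 2 ^ (N - T n))%N) (gpt N j).
  by move=> jN; apply: gT (jT j jN) (cell_div TN (cell_left _ _ _)).
symmetry; apply: (@cross_close _ _ _ _ _ _ (2 ^- n)).
- by move=> j jN; apply: pclose_sym; apply: Pg.
- exact: pclose_sym.
- move=> j jN; have := safe _ (jT j jN).
  have -> : 8 * 2 ^- n = 6 * 2 ^- n + 2 ^- n + 2 ^- n :> R by ring.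
  move=> /pfar_close/(_ zab)/pfar_sym/pfar_close; apply.
  exact: Pg.
- by move=> j jN; apply: gstep.
- by rewrite gpt0.
- by rewrite gpt1.
Qed.

Lemma wind_lim00 : wind_lim (0, 0) false.
Proof.
exists 0%N => N _; apply: cross_lower => j jN.
by have [] := gsq (dyR_unit R jN).
Qed.

Lemma wind_lim11 : ~ (g @` `[0, 1]%classic) (1, 1) -> wind_lim (1, 1) true.
Proof.
move=> /(far_of_notin gcont)[n Hn]; exists (T n) => N TN.
apply: (@cross_upper _ _ _ _ (2 ^- n)).
- by rewrite expn_gt0.
- move=> j jN; apply: pfarW (Hn _ (dyR_unit R jN)).
  by rewrite ler_wpM2r ?ler_nat // invr_ge0 ltW ?exp2_gt0.
- by move=> j jN; apply: gstep.
- by move=> j jN; have [] := gsq (dyR_le1 jN).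
- by rewrite gpt0 /= ltr01.
- by rewrite gpt1.
Qed.

End Winding.
End Main.

(** * Bisection *)

Section Bisection.
Local Open Scope classical_set_scope.
Local Open Scope ring_scope.
Variables (R : realType) (f g : R -> R * R).
Hypotheses (hf : computable_path f) (hg : computable_path g).
Hypotheses (f0 : f 0 = (0, 0)) (f1 : f 1 = (1, 1)).
Hypotheses (g0 : g 0 = (0, 1)) (g1 : g 1 = (1, 0)).
Hypothesis f_avoids : forall N i, (i < 2 ^ N)%N ->
  ~ (g @` `[0, 1]%classic) (f (dyR R N i)).

(** Search for a precision [n] at which all codes along [g] are verified to be far from the code of
    the point on [f], then count crossings with these codes. The search ends because the point is
    off the range of [g]. *)
Lemma decide_wind : exists2 out : nat -> nat -> bool,
  rec2 (fun N i => out N i : nat) &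
  forall N i, (i < 2 ^ N)%N -> wind_lim g (f (dyR R N i)) (out N i).
Proof.
have [[[_ f_in] f_comp] [[gcont gin] g_comp]] := (hf, hg).
have [F1 [F2 [rF1 rF2 Ff]]] := left_approx f_comp.
have [T [G1 [G2 [rT rG1 rG2 Gg]]]] := cell_approx g_comp.
pose safe n N i := all (fun j =>
  farQ n (G1 n j) (F1 n N i) || farQ n (G2 n j) (F2 n N i)) (iota 0 (2 ^ T n)).
(* The first alternative ends the search at once for [i] out of range, so that it is total. *)
pose P n v := (2 ^ v#0 <= v#1)%N || safe n v#0 v#1.
have safeE n N i : safe n N i -> forall j, (j < 2 ^ T n)%N ->
    pfar (8 * 2 ^- n) (codeR R (G1 n j) (G2 n j)) (codeR R (F1 n N i) (F2 n N i)).
  move=> /allP S j jT; have := S j; rewrite mem_iota add0n => /(_ jT).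
  by rewrite !(farQE R) => /orP[h|h]; [left | right].
have exP (v : 2.-tuple nat) : exists n, P n v.
  rewrite /P; have [_|vN] := leqP; first by exists 0%N.
  have [n Hn] := far_of_notin gcont (f_avoids vN).
  exists n; apply/allP => j; rewrite mem_iota add0n => /andP[_ jT].
  rewrite !(farQE R).
  have [Gc Fc] := (Gg n j _ jT (cell_left _ _ _), Ff n _ _ vN).
  have /pfar_sym := Hn _ (dyR_unit R jT).
  have -> : 10 * 2 ^- n = 8 * 2 ^- n + 2 ^- n + 2 ^- n :> R by ring.
  move=> /pfar_close/(_ (pclose_sym Fc))/pfar_sym/pfar_close/(_ (pclose_sym Gc)).
  by move=> /pfar_sym[] h; apply/orP; [left | right].
have recP : recF 3 (fun w => P w#0 (behead w) : nat).
  apply: (@recF_ext _ (fun w => (2 ^ w#1 <= w#2)%N || all ((fun j w =>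
    farQ w#0 (G1 w#0 j) (F1 w#0 w#1 w#2) || farQ w#0 (G2 w#0 j) (F2 w#0 w#1 w#2))^~ w)
     (iota 0 (2 ^ T w#0)))).
    by move=> w; rewrite /P !nth_behead.
  apply: recF_or; first by rec_tac.
  apply: recF_all; last by rec_tac; apply: (recF_app1 rT); rec_tac.
  by apply: recF_or; apply: recF_farQ; rec_tac;
    lazymatch goal with
    | |- recF _ (fun v => G1 _ _) => apply: (recF_app2 rG1)
    | |- recF _ (fun v => G2 _ _) => apply: (recF_app2 rG2)
    | |- recF _ (fun v => F1 _ _ _) => apply: (recF_app3 rF1)
    | |- recF _ (fun v => F2 _ _ _) => apply: (recF_app3 rF2)
    | _ => idtac
    end; rec_tac.
have [prc rprc prcP] := recF_mu recP exP.
pose n_ N i := prc [:: N; i].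
have rn : rec2 n_.
  have := recF_app (n := 2) (s := [:: fun v => v#0; fun v => v#1]) rprc erefl.
  by apply => -[|[|j]] // _; exact: recF_var.
pose chi n N i j := (j < 2 ^ T n)%N && ltQ (G1 n j) (F1 n N i).
pose edge n N i j := (chi n N i j (+) chi n N i j.+1) && ltQ (G2 n j) (F2 n N i).
exists (fun N i => odd (\sum_(0 <= j < 2 ^ T (n_ N i)) edge (n_ N i) N i j)).
  apply: recF_odd; apply: (@recF_sum 2 (fun j v => edge (n_ v#0 v#1) v#0 v#1 j)).
    have rT' : recF 3 (fun w => T (n_ (drop 1 w)#0 (drop 1 w)#1)).
      by apply: (recF_app1 rT); apply: (recF_app2 rn); rec_tac.
    have rn' : recF 3 (fun w => n_ (drop 1 w)#0 (drop 1 w)#1).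
      by apply: (recF_app2 rn); rec_tac.
    have rF1' : recF 3 (fun w => F1 (n_ (drop 1 w)#0 (drop 1 w)#1) (drop 1 w)#0 (drop 1 w)#1).
      by apply: (recF_app3 rF1); rec_tac.
    have rF2' : recF 3 (fun w => F2 (n_ (drop 1 w)#0 (drop 1 w)#1) (drop 1 w)#0 (drop 1 w)#1).
      by apply: (recF_app3 rF2); rec_tac.
    rewrite /edge /chi; rec_tac; apply: recF_ltQ => //;
      lazymatch goal with
      | |- recF _ (fun v => G1 _ _) => apply: (recF_app2 rG1)
      | |- recF _ (fun v => G2 _ _) => apply: (recF_app2 rG2)
      end; rec_tac.
  by rec_tac; apply: (recF_app1 rT); apply: (recF_app2 rn); rec_tac.
move=> N i iN; set n := n_ N i.
have S : safe n N i by have := prcP [tuple N; i]; rewrite /P /= leqNgt iN.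
have [] : unit_square (f (dyR R N i)) by apply: f_in; exists (dyR R N i) => //; exact: dyR_unit.
rewrite /= !in_itv /= => /andP[_ z1] /andP[_ z2].
exists (T n) => M TM.
rewrite -(wind_code g0 g1 Gg z1 z2 TM (Ff n _ _ iN) (safeE _ _ _ S)).
by rewrite /cross /par; congr odd; apply: eq_bigr => j _; rewrite /edge /chi !(ltQE R).
Qed.

Lemma bisection : ~ (g @` `[0, 1]%classic) (1, 1) ->
  exists x p, [/\ 0 <= x <= 1, rec1 p, cauchy_rep p x &
    (g @` `[0, 1]%classic) (f x)].
Proof.
move=> g11.
have [[[_ f_in] f_comp] [[gcont gin] g_comp]] := (hf, hg).
have [out rout outP] := decide_wind.
(* A midpoint of parity true becomes the right end, so the left half is kept; otherwise the right
   half is. *)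
pose b := nat_rec (fun=> nat) 0%N (fun N i => (i * 2 + ~~ out N.+1 (i * 2).+1)%N).
have bS N : (b N.+1 = b N * 2 \/ b N.+1 = (b N * 2).+1)%N.
  by rewrite /=; case: (out _ _); [left | right]; rewrite ?addn0 ?addn1.
have bN N : (b N < 2 ^ N)%N.
  by elim: N => // N IH; rewrite expnS; case: (bS N) => ->; lia.
have rb : rec1 b.
  apply: (@recF_prim 1 (fun=> 0%N) (fun N i _ => (i * 2 + ~~ out N.+1 (i * 2).+1)%N));
    rec_tac.
  by apply: (recF_app2 (f := fun N i => out N i : nat) rout); rec_tac.
have inv N : wind_lim g (f (dyR R N (b N))) false /\
             wind_lim g (f (dyR R N (b N).+1)) true.
  elim: N => [|N [IHl IHr]].
    rewrite /dyR /= mul0r f0 expr0 divr1 f1; split.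
      exact: wind_lim00.
    (* The right end [f 1] is not among the points covered by [f_avoids], whence the separate
       hypothesis [g11]. *)
    by have [T [G1 [G2 [_ _ _ Gg]]]] := cell_approx g_comp; apply: wind_lim11 Gg g11.
  have mid : ((b N * 2).+1 < 2 ^ N.+1)%N by rewrite expnS; have := bN N; lia.
  have dl : dyR R N.+1 (b N * 2) = dyR R N (b N).
    by rewrite -(dyR_refine R N 1) addn1 expn1.
  have dr : dyR R N.+1 (b N * 2).+2 = dyR R N (b N).+1.
    by rewrite -(dyR_refine R N 1) addn1 expn1 mulSn.
  have := outP _ _ mid; rewrite /=; case: (out _ _) => h.
    by rewrite addn0 dl.
  by rewrite addn1 dr.
have [s sP] := cell_limit R bS; exists s, (fun N => dy N (b N)).
have s01 := cell_unit (bN 0%N) (sP 0%N).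
split => //.
- by apply: recF_dy => //; rec_tac.
- by move=> N; rewrite ratr_dyR; apply: cell_dist.
(* Were [f s] off the range of [g], the parity would be constant near [f s], whereas the two ends of
   every cell around [s] have different parities. *)
apply: contrapT => sg; have [n Hn] := far_of_notin gcont sg.
have [Tf [F1 [F2 [_ _ _ Ff]]]] := cell_approx f_comp.
have [T [G1 [G2 [_ _ _ Gg]]]] := cell_approx g_comp.
have [] : unit_square (f s) by apply: f_in; exists s.
rewrite /= !in_itv /= => /andP[_ z1] /andP[_ z2].
(* Precision [n.+1], because two values of [f] on the cell are compared through the code of the
   cell. *)
set K := Tf n.+1.
have fclose x y : cell K (b K) x -> cell K (b K) y -> pclose (2 ^- n) (f x) (f y).
  move=> cx cy; have -> : 2 ^- n = 2 ^- n.+1 + 2 ^- n.+1 :> R.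
    by rewrite exprS invfM; field; rewrite gt_eqF // exp2_gt0.
  apply: (@pclose_trans _ _ _ _ (codeR R (F1 n.+1 (b K)) (F2 n.+1 (b K)))).
    by apply: pclose_sym; apply: Ff.
  exact: Ff.
have [[N0 H0] [N1 H1]] := inv K.
pose N := maxn (T n) (maxn N0 N1).
have far6 t : 0 <= t <= 1 -> pfar (6 * 2 ^- n) (f s) (g t).
  by move=> /Hn; apply: pfarW; rewrite ler_wpM2r ?ler_nat // invr_ge0 ltW ?exp2_gt0.
have loc y : cell K (b K) y -> wind g N (f s) = wind g N (f y).
  move=> cy; apply: (wind_local g0 g1 Gg z1 z2 (leq_maxl _ _) far6).
  exact: fclose (sP K) cy.
have := loc _ (cell_left R K (b K)); rewrite (loc _ (cell_right R K (b K))).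
by rewrite H0 ?H1 // !leq_max leqnn !orbT.
Qed.

End Bisection.

(** * Case distinction on intersections at dyadic parameters *)

Unset Implicit Arguments.
Local Open Scope classical_set_scope.
Local Open Scope ring_scope.

Theorem theorem1p3 (R : realType) (f g : R -> R * R)
    (hf : computable_path f) (hg : computable_path g)
    (f0 : f 0 = (0, 0)) (f1 : f 1 = (1, 1))
    (g0 : g 0 = (0, 1)) (g1 : g 1 = (1, 0)) :
  exists x : R * R, computable_point x /\
    (f @` `[0, 1]%classic `&` g @` `[0, 1]%classic) x.
Proof.
suff [x [p [x01 rp px gx]]] : exists x p, [/\ 0 <= x <= 1, rec1 p,
    cauchy_rep p x & (g @` `[0, 1]%classic) (f x)].
  exists (f x); split; first by apply: computable_image x01 rp px; exact: hf.2.
  by split => //; exists x.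
(* The parameter 1 is treated apart, since the dyadic points [dyR R N i] with [i < 2 ^ N] do not
   include it. *)
have [g11|g11] := pselect ((g @` `[0, 1]%classic) (1, 1)).
  exists 1, (fun=> dy 0 1); rewrite f1; split => //.
  - by rewrite ler01 lexx.
  - exact: recF_const.
  - by move=> n; rewrite ratr_dyR /dyR expr0 divr1 subrr normr0 invr_ge0 ltW ?exp2_gt0.
have [avoid|] := pselect (forall N i, (i < 2 ^ N)%N ->
    ~ (g @` `[0, 1]%classic) (f (dyR R N i))).
  exact: bisection avoid g11.
move=> /existsNP[N /existsNP[i /not_implyP[iN /contrapT gfi]]].
exists (dyR R N i), (dyname N i); split => //.
- exact: dyR_unit.
- by apply: recF_dyname; rec_tac.
- exact: dyname_name.
Qed.
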